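(* Assume that $X$ is of Pareto-type with index $\alpha=2$, i.e. $1-F(x)\sim x^{-2}\ell(x)$ as $x\to\infty$ with $\ell$ slowly varying, that $\mu_2=\infty$, and that the counting process $\{N(t);\,t\geq 0\}$ $\mathcal{D}$-averages in time to the random variable $\Lambda$. Define $(a^\prime_t)_{t>0}$ by $\lim_{t\to\infty}t\,(a^{\prime}_t)^{-2}\tilde\ell(a^\prime_t)=1$ with $\tilde\ell(x)=\int_0^x\frac{\ell(u)}{u}\,du\in\mathrm{RV}_0$. Then $$\frac{\sqrt{N(t)}}{a^\prime_t}\,\widehat{\mathrm{CoVar}(X)}\stackrel{\mathcal{D}}{\longrightarrow}\frac{\sqrt2}{\mu_1}\,\sqrt{\Lambda}\quad\text{as } t\rightarrow\infty$$ and $$\frac{t}{a^\prime_t}\,\frac{\widehat{\mathrm{CoVar}(X)}}{\sqrt{N(t)}}\stackrel{\mathcal{D}}{\longrightarrow}\frac{\sqrt2}{\mu_1}\,\frac{1}{\sqrt{\Lambda}}\quad\text{as } t\rightarrow\infty.$$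
   Context: $X$ is a positive random variable with distribution function $F$ and $\mu_\beta:=\mathbb{E}X^\beta\le\infty$; $X_1,X_2,\ldots$ are i.i.d. copies of $X$; $\{N(t);\,t\geq 0\}$ is a counting process (nonnegative integer-valued, nondecreasing in $t$) independent of the $X_i$'s. The sample coefficient of variation based on $X_1,\ldots,X_{N(t)}$ is $\widehat{\mathrm{CoVar}(X)}:=S/\overline X$, where $\overline X:=\frac{1}{N(t)}\sum_{i=1}^{N(t)}X_i$ and $S\ge0$ with $S^2:=\frac{1}{N(t)}\sum_{i=1}^{N(t)}(X_i-\overline X)^2$; on $\{N(t)=0\}$ it, and its quotient by $\sqrt{N(t)}$, are set to $0$. $X$ (or $F$) is of Pareto-type with index $\alpha>0$ if $1-F(x)\sim x^{-\alpha}\ell(x)$ as $x\to\infty$ for a slowly varying function $\ell$. $\mathrm{RV}_0$ is the class of slowly varying functions. The counting process $\mathcal{D}$-averages in time to $\Lambda$ if $N(t)/t\stackrel{\mathcal{D}}{\longrightarrow}\Lambda$ (convergence in distribution) as $t\to\infty$, where $\mathbb{P}[\Lambda>0]=1$.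
   Formalization: It is assumed explicitly that $a'_t\to\infty$ (the displayed limit alone also admits solutions tending to 0, for which the claim fails) and that $\ell(u)/u$ is integrable on $(0,x]$ for every $x>0$, so that $\tilde\ell$ is well defined. *)

(* Defs.v *)
From HB Require Import structures.
From mathcomp Require Import all_boot all_order all_algebra.
From mathcomp Require Import finmap.
From mathcomp Require Import all_classical all_reals all_analysis.

Set Implicit Arguments.
Unset Strict Implicit.
Unset Printing Implicit Defensive.

Import Order.TTheory GRing.Theory Num.Theory.
Import numFieldNormedType.Exports.

Local Open Scope classical_set_scope.
Local Open Scope ring_scope.

(* The class RV_0. Only the behaviour at infinity is constrained: [L] need not
   be positive, nor bounded, near the origin. *)
Definition slowly_varying (R : realType) (L : R -> R) : Prop :=
  [/\ measurable_fun (`]0, +oo[ : set R) L,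
      \forall x \near +oo, 0 < L x &
      forall lam : R, 0 < lam -> L (lam * x) / L x @[x --> +oo] --> (1 : R)].

(* 1 - F(x) ~ x^(-alpha) ell(x) as x -> oo, with F the distribution function
   of X. *)
Definition pareto_type (d : measure_display) (T : measurableType d)
    (R : realType) (P : probability T R) (X : {RV P >-> R})
    (alpha : R) (ell : R -> R) : Prop :=
  [/\ 0 < alpha, slowly_varying ell &
      (1 - fine (cdf X x)) / (x `^ (- alpha) * ell x) @[x --> +oo] --> (1 : R)].

Definition mu_ (d : measure_display) (T : measurableType d) (R : realType)
    (P : probability T R) (X : {RV P >-> R}) (beta : R) : \bar R :=
  'E_P[fun w => X w `^ beta].

(* The value is meaningful when u |-> ell u / u is integrable on ]0, x]. *)
Definition tilde_ell (R : realType) (ell : R -> R) (x : R) : R :=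
  \int[lebesgue_measure]_(u in `]0, x]) (ell u / u).

Definition identically_distributed (d : measure_display) (T : measurableType d)
    (R : realType) (P : probability T R) (X Y : {RV P >-> R}) : Prop :=
  forall B : set R, measurable B -> P (X @^-1` B) = P (Y @^-1` B).

Definition mutually_independent (d : measure_display) (T : measurableType d)
    (R : realType) (P : probability T R) (X_ : nat -> {RV P >-> R}) : Prop :=
  forall (J : {fset nat}) (B : nat -> set R), (forall i, measurable (B i)) ->
    P (\bigcap_(i in [set` J]) X_ i @^-1` B i) =
    (\prod_(i <- J) P (X_ i @^-1` B i))%E.

Definition iid_copies (d : measure_display) (T : measurableType d)
    (R : realType) (P : probability T R)
    (X : {RV P >-> R}) (X_ : nat -> {RV P >-> R}) : Prop :=
  mutually_independent X_ /\ forall i, identically_distributed (X_ i) X.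

(* The sigma-algebra on T generated by the family (Y i), i in D. *)
Definition sigma_family (d d' : measure_display) (T : measurableType d)
    (T' : measurableType d') (I : Type) (D : set I) (Y : I -> T -> T') :
    set (set T) :=
  <<s \bigcup_(i in D) preimage_set_system setT (Y i) measurable >>.

(* Only the times t >= 0 of the process are relevant. *)
Definition counting_process (d : measure_display) (T : measurableType d)
    (R : realType) (P : probability T R) (N : R -> {RV P >-> nat}) : Prop :=
  forall (w : T) (s t : R), 0 <= s -> s <= t -> (N s w <= N t w)%N.

Definition process_independent (d : measure_display) (T : measurableType d)
    (R : realType) (P : probability T R)
    (N : R -> {RV P >-> nat}) (X_ : nat -> {RV P >-> R}) : Prop :=
  forall A B : set T,
    sigma_family [set t : R | 0 <= t] N A -> sigma_family [set: nat] X_ B ->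
    P (A `&` B) = (P A * P B)%E.

(* Convergence in distribution as t -> oo, in terms of the distribution
   functions; the limit may live on another probability space. *)
Definition cvg_in_distribution (d d' : measure_display)
    (T : measurableType d) (T' : measurableType d') (R : realType)
    (P : probability T R) (P' : probability T' R)
    (Y : R -> T -> R) (Z : T' -> R) : Prop :=
  [/\ forall t, measurable_fun [set: T] (Y t),
      measurable_fun [set: T'] Z &
      forall x : R,
        {for x, continuous (fun y => P' [set w | Z w <= y])} ->
        P [set w | Y t w <= x] @[t --> +oo] --> P' [set w | Z w <= x]].

Definition D_averages_in_time (d d' : measure_display)
    (T : measurableType d) (T' : measurableType d') (R : realType)
    (P : probability T R) (P' : probability T' R)
    (N : R -> {RV P >-> nat}) (Lambda : {RV P' >-> R}) : Prop :=
  cvg_in_distribution P P' (fun t w => (N t w)%:R / t) Lambda /\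
  P' [set w | 0 < Lambda w] = 1%E.

Definition sample_mean (R : realType) (x : nat -> R) (n : nat) : R :=
  n%:R^-1 * \sum_(i < n) x i.

Definition sample_sd (R : realType) (x : nat -> R) (n : nat) : R :=
  Num.sqrt (n%:R^-1 * \sum_(i < n) (x i - sample_mean x n) ^+ 2).

(* For n = 0 this is 0, by the convention 0^-1 = 0; see [sample_covar0]. *)
Definition sample_covar (R : realType) (x : nat -> R) (n : nat) : R :=
  sample_sd x n / sample_mean x n.

Lemma sample_covar0 (R : realType) (x : nat -> R) :
  sample_covar x 0 = 0 /\ sample_covar x 0 / Num.sqrt 0%:R = 0.
Proof.
have h : sample_covar x 0 = 0.
  by rewrite /sample_covar /sample_mean big_ord0 mulr0 invr0 mulr0.
by rewrite h mul0r.
Qed.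

Definition CoVar (d : measure_display) (T : measurableType d)
    (R : realType) (P : probability T R) (X_ : nat -> {RV P >-> R})
    (N : {RV P >-> nat}) (w : T) : R :=
  sample_covar (fun i => X_ i w) (N w).

(* Main.v *)
(** Write H(x) = P(X > x) and K(x) = E[min(X, x)^2], which tends to infinity
    since mu_2 = oo.  As x^2 H(x) ~ ell(x) varies slowly and each halving of x
    lowers K by at least 3/4 x^2 H(x), we get x^2 H(x) = o(K(x)); hence K varies
    slowly, E[X^2; X <= x] ~ K(x) and E[X^4; X <= x] = o(x^2 K(x)).  Fubini gives
    K(x) = 2 int_0^x u H(u) du, so that tilde_ell ~ K / 2, and the normalization
    of a reads t K(a_t) / a_t^2 -> 2.

    Truncating the X_i at the level a_t and applying Chebyshev's inequality to
    sum X_i^2 and sum X_i yields, uniformly for n in [dl t, M t],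
    sqrt t / a_t * sample_covar(X_1, .., X_n) -> sqrt 2 / mu_1 in probability.
    Conditioning on N(t), which is independent of the X_i and of order t, gives
    V_t := sqrt t / a_t * CoVar -> sqrt 2 / mu_1 in probability.  The two
    statistics are sqrt (N(t) / t) * V_t and V_t / sqrt (N(t) / t), and a
    Slutsky argument on distribution functions concludes. *)

Require Import Defs.
From HB Require Import structures.
From mathcomp Require Import all_boot all_order all_algebra.
From mathcomp Require Import all_classical all_reals all_analysis.
From mathcomp Require Import finmap measurable_realfun ring lra.

Set Implicit Arguments.
Unset Strict Implicit.
Unset Printing Implicit Defensive.

Import Order.TTheory GRing.Theory Num.Theory.
Import numFieldNormedType.Exports.

Local Open Scope classical_set_scope.
Local Open Scope ring_scope.

(** Every relation between truncated moments comes from an inequality between cutoffs of a single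
    real r, integrated by monotonicity of [Exp]. Two cutoffs coexist because they serve different
    ends: E[min(X, x)^2] is monotone in x and is an exact integral of the tail, whereas X 1(X <= x)
    reproduces the sample sums as soon as all the X_i lie below the level. Finiteness of mu_1 is not
    assumed; a doubling argument extracts it from the index 2. The function [ell] is tied to the
    tail near infinity only, so its integral up to a fixed threshold has to be absorbed by K -> oo.

    The squares X_i^2 have infinite mean, which forces the truncation at a_t and makes the fourth
    truncated moment the variance bound. Since S^2 is the mean of the squares minus the squared
    mean, the normalized coefficient has the form sqrt(q - r m^2) / m, continuous at (2, mu_1, 0).
    The deviation bound holds for each n separately, so a random index costs only an average over
    the values of N(t). Scaling by the deterministic sqrt t, not by sqrt (N(t)), separates V_t,
    whose limit is constant, from N(t) / t. *)

Lemma cvg_near_eq (T : Type) (U : topologicalType) (F : set_system T)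
    {FF : Filter F} (f g : T -> U) (l : U) :
  f x @[x --> F] --> l -> (\forall x \near F, f x = g x) ->
  g x @[x --> F] --> l.
Proof.
by move=> fl fg; apply: cvg_trans fl; apply: near_eq_cvg; exact: fg.
Qed.

(** The ratio f(lam x) / f(x) is the product of f / g at lam x, of g(lam x) / g(x) and of g / f at
    x, with limits c, 1 and 1 / c. Slow variation is passed in this way from [ell] to [sq_tail], and
    from [clip_moment X 2] to [tilde_ell]. *)
Lemma eqv_cvg1_scale (R : realType) (f g : R -> R) (c lam : R) :
  c != 0 -> 0 < lam -> f x / g x @[x --> +oo] --> c ->
  g (lam * x) / g x @[x --> +oo] --> (1 : R) ->
  f (lam * x) / f x @[x --> +oo] --> (1 : R).
Proof.
move=> c0 lam0 fg gl.
have lamy : lam * x @[x --> +oo] --> +oo by apply: gt0_cvgMry.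
have fgl : f (lam * x) / g (lam * x) @[x --> +oo] --> c.
  exact: (@cvg_comp _ _ _ (fun x => lam * x) (fun x => f x / g x) _ _ _ lamy fg).
have fgV : (f x / g x)^-1 @[x --> +oo] --> c^-1 by apply: cvgV.
have L : f (lam * x) / g (lam * x) * (g (lam * x) / g x) * (f x / g x)^-1
    @[x --> +oo] --> c * 1 / c by apply: cvgM => //; exact: cvgM.
rewrite mulr1 divff// in L.
apply: (cvg_near_eq L); near=> x.
(* As 0^-1 = 0, a nonzero quotient certifies that numerator and denominator are both nonzero. *)
have n1 : f x / g x != 0 by near: x; exact: cvgr_neq0 fg c0.
have n2 : f (lam * x) / g (lam * x) != 0 by near: x; exact: cvgr_neq0 fgl c0.
rewrite /=; move: n1 n2; rewrite !mulf_eq0 !invr_eq0 !negb_or.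
move=> /andP[? ?] /andP[? ?]; field; apply/and3P; split => //.
Unshelve. all: by end_near. Qed.

(** * Bounded functionals and truncated moments *)

(** The cutoffs vanish for r <= 0 because [X] is positive only almost surely, while the inequalities
    between them are proved at every real r. For x > 0 they satisfy clip^2 = trunc_at^2 + x^2
    over. *)
Definition clip (R : realType) (x r : R) : R := Num.max 0 (Num.min r x).

Definition trunc_at (R : realType) (x r : R) : R :=
  if (0 < r) && (r <= x) then r else 0.

Definition over (R : realType) (x r : R) : R := (x < r)%R%:R.

(** This class is closed under sums, products and powers and is integrable for every probability, so
    linearity and monotonicity of [Exp] come with side conditions that are settled by [auto]. *)
Definition bounded_measurable d (U : measurableType d) (R : realType)
    (f : U -> R) : Prop :=
  measurable_fun [set: U] f /\ exists M, forall r, `|f r| <= M.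

Section bounded_measurable.
Context d (U : measurableType d) {R : realType}.
Implicit Types f g : U -> R.

Lemma bounded_measurable_cst (c : R) : bounded_measurable (fun _ : U => c).
Proof. by split; [exact: measurable_cst|exists `|c|]. Qed.

Lemma bounded_measurableD f g : bounded_measurable f -> bounded_measurable g ->
  bounded_measurable (fun r => f r + g r).
Proof.
move=> [mf [M fM]] [mg [N gN]]; split; first exact: measurable_funD.
by exists (M + N) => r; rewrite (le_trans (ler_normD _ _))// lerD.
Qed.

Lemma bounded_measurableM f g : bounded_measurable f -> bounded_measurable g ->
  bounded_measurable (fun r => f r * g r).
Proof.
move=> [mf [M fM]] [mg [N gN]]; split; first exact: measurable_funM.
by exists (M * N) => r; rewrite normrM ler_pM.
Qed.

Lemma bounded_measurableB f g : bounded_measurable f -> bounded_measurable g ->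
  bounded_measurable (fun r => f r - g r).
Proof.
move=> bf bg; have := bounded_measurableD bf
  (bounded_measurableM (bounded_measurable_cst (-1)) bg).
by under eq_fun do rewrite mulN1r.
Qed.

Lemma bounded_measurableX f n : bounded_measurable f ->
  bounded_measurable (fun r => f r ^+ n).
Proof.
move=> bf; elim: n => [|n IH].
  by under eq_fun do rewrite expr0; exact: bounded_measurable_cst.
by under eq_fun do rewrite exprS; exact: bounded_measurableM.
Qed.

End bounded_measurable.

Section bounded_measurable_truncations.
Context {R : realType}.

Lemma bounded_measurable_clip (x : R) : bounded_measurable (clip x).
Proof.
split.
  by apply: measurable_maxr => //; exact: measurable_minr.
exists `|x| => r; rewrite /clip /Num.max /Num.min.
rewrite ler_norml; have n0 := normr_ge0 x; have n1 := ler_norm x.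
by case: (ltP r x) => rx; case: ltP => r0; apply/andP; split; lra.
Qed.

Lemma bounded_measurable_over (x : R) : bounded_measurable (over x).
Proof.
split.
  rewrite (_ : over x = \1_(`]x, +oo[ : set R)).
    exact: measurable_indic.
  by apply/funext => r; rewrite /over indicE mem_setE in_itv/= andbT.
by exists 1 => r; rewrite /over; case: ltP; rewrite ?normr0 ?normr1.
Qed.

Lemma bounded_measurable_trunc_at (x : R) : bounded_measurable (trunc_at x).
Proof.
split.
  rewrite (_ : trunc_at x = fun r => r * \1_(`]0, x] : set R) r).
    by apply: measurable_funM => //; exact: measurable_indic.
  apply/funext => r; rewrite /trunc_at indicE mem_setE in_itv/=.
  by case: ifP => _; rewrite ?mulr1 ?mulr0.
exists `|x| => r; rewrite /trunc_at; case: ifPn => [/andP[r0 rx]|_].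
  by rewrite !ger0_norm// ltW// (lt_le_trans r0).
by rewrite normr0.
Qed.

End bounded_measurable_truncations.

#[local] Hint Resolve bounded_measurable_cst bounded_measurableD
  bounded_measurableM bounded_measurableB bounded_measurableX
  bounded_measurable_clip bounded_measurable_over bounded_measurable_trunc_at
  : bmeas.

Section bounded_moments.
Context d (T : measurableType d) (R : realType) (P : probability T R).

Lemma integrable_bounded_measurable (f : T -> R) : bounded_measurable f ->
  P.-integrable [set: T] (EFin \o f).
Proof.
move=> [mf [M fM]]; apply: measurable_bounded_integrable => //.
- by rewrite (le_lt_trans (probability_le1 P measurableT))// ltry.
- exists M; split; first exact: num_real.
  by move=> y My z _ /=; rewrite (le_trans (fM _))// ltW.
Qed.

Lemma bounded_measurable_comp d' (U : measurableType d') (X : T -> U)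
    (f : U -> R) : measurable_fun [set: T] X ->
  bounded_measurable f -> bounded_measurable (f \o X).
Proof.
by move=> mX [mf [M fM]]; split; [exact: measurableT_comp|exists M => w /=].
Qed.

Variable X : {RV P >-> R}.

Definition Exp (f : R -> R) : R := \int[P]_w f (X w).

Lemma integrable_bounded_comp f : bounded_measurable f ->
  P.-integrable [set: T] (fun w => (f (X w))%:E).
Proof.
move=> bf; apply: integrable_bounded_measurable.
by apply: (bounded_measurable_comp (X := X)).
Qed.

Lemma Exp_EFin f : bounded_measurable f ->
  (\int[P]_w (f (X w))%:E)%E = (Exp f)%:E.
Proof.
move=> bf; rewrite /Exp /Rintegral fineK//.
by apply: integrable_fin_num => //; exact: integrable_bounded_comp.
Qed.

Lemma Exp_le f g : bounded_measurable f -> bounded_measurable g ->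
  (forall r, f r <= g r) -> Exp f <= Exp g.
Proof.
move=> bf bg fg; apply: le_Rintegral => //; exact: integrable_bounded_comp.
Qed.

Lemma ExpD f g : bounded_measurable f -> bounded_measurable g ->
  Exp (fun r => f r + g r) = Exp f + Exp g.
Proof.
by move=> bf bg; apply: RintegralD => //; exact: integrable_bounded_comp.
Qed.

Lemma ExpB f g : bounded_measurable f -> bounded_measurable g ->
  Exp (fun r => f r - g r) = Exp f - Exp g.
Proof.
by move=> bf bg; apply: RintegralB => //; exact: integrable_bounded_comp.
Qed.

Lemma ExpZ c f : bounded_measurable f -> Exp (fun r => c * f r) = c * Exp f.
Proof.
by move=> bf; apply: RintegralZl => //; exact: integrable_bounded_comp.
Qed.

Lemma Exp_cst c : Exp (fun=> c) = c.
Proof.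
rewrite /Exp (Rintegral_cst P)// [X in fine X](_ : _ = 1%E) ?mulr1//.
exact: probability_setT.
Qed.

Lemma Exp_ge0 f : (forall r, 0 <= f r) -> 0 <= Exp f.
Proof. by move=> f0; apply: Rintegral_ge0. Qed.

End bounded_moments.

Lemma clipE (R : realType) (x r : R) : 0 <= x ->
  clip x r = if r <= 0 then 0 else if r <= x then r else x.
Proof.
rewrite /clip /Num.max /Num.min => x0.
by case: (ltP r x) => rx; [case: (ltP 0 r) => r1|case: (ltP 0 x) => r1];
  case: (leP r 0) => r2; case: (leP r x) => r3 //; lra.
Qed.

Section truncated_moments.
Context d (T : measurableType d) (R : realType) (P : probability T R).
Variable X : {RV P >-> R}.
Implicit Types x y lam : R.

(** This is H of the overview, and [clip_moment 2] is K; for n >= 1, [trunc_moment n x] is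
    E[X^n; 0 < X <= x]. *)
Definition tail x : R := Exp X (over x).

Definition trunc_moment n x : R := Exp X (fun r => trunc_at x r ^+ n).

Definition clip_moment n x : R := Exp X (fun r => clip x r ^+ n).

Definition sq_tail x : R := x ^+ 2 * tail x.

Lemma tail_ge0 x : 0 <= tail x.
Proof. by apply: Exp_ge0 => r; rewrite /over ler0n. Qed.

Lemma tail_nonincreasing x y : x <= y -> tail y <= tail x.
Proof.
move=> xy; apply: Exp_le; auto with bmeas => r.
by rewrite /over ler_nat; case: (ltP y r) => //= yr; rewrite (le_lt_trans xy).
Qed.

(** For r > x, halving the level lowers the squared cutoff from x^2 to x^2 / 4, hence the factor 3 /
    4. *)
Lemma clip_moment2_half x : 0 < x ->
  3 / 4 * sq_tail x + clip_moment 2 (x / 2) <= clip_moment 2 x.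
Proof.
move=> x0; rewrite /sq_tail /tail /clip_moment -!ExpZ -?ExpD; auto 10 with bmeas.
apply: Exp_le; auto 10 with bmeas => r.
rewrite !clipE /over; [|lra|lra].
by case: (leP r 0) => r1; case: (leP r (x / 2)) => r2;
  case: (leP r x) => r3 //=; nra.
Qed.

Lemma clip_moment_nondecreasing n x y : 0 <= x -> x <= y ->
  clip_moment n x <= clip_moment n y.
Proof.
move=> x0 xy; apply: Exp_le; auto with bmeas => r.
rewrite !clipE; [|lra|lra].
apply: lerXn2r; rewrite ?nnegrE.
- by case: (leP r 0) => r1 //; case: ifP => // _; lra.
- by case: (leP r 0) => r1 //; case: ifP => // _; lra.
- by case: (leP r 0) => r1; case: (leP r x) => r2;
  case: (leP r y) => r3 //=; lra.
Qed.

(** Raising the level from x to lam x changes the cutoff only for r > x, where its square is at most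
    lam^2 x^2. *)
Lemma clip_moment2_scale x lam : 0 < x -> 1 <= lam ->
  clip_moment 2 (lam * x) <= clip_moment 2 x + lam ^+ 2 * sq_tail x.
Proof.
move=> x0 lam1; rewrite /sq_tail /tail /clip_moment -!ExpZ -?ExpD; auto 10 with bmeas.
apply: Exp_le; auto 10 with bmeas => r.
have lx0 : 0 <= lam * x by nra.
rewrite !clipE /over; [|lra|lra].
case: (leP r 0) => r1; case: (leP r x) => r3 //=; rewrite ?mulr0 ?mulr1 ?addr0; try lra.
  have -> : r <= lam * x by nra.
  lra.
case: (leP r (lam * x)) => r2; first by nra.
have : 0 <= x ^+ 2 by exact: sqr_ge0.
lra.
Qed.

Lemma clip_moment1_double x : 0 < x ->
  clip_moment 1 (2 * x) <= clip_moment 1 x + x * tail x.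
Proof.
move=> x0; rewrite /sq_tail /tail /clip_moment -!ExpZ -?ExpD; auto 10 with bmeas.
apply: Exp_le; auto 10 with bmeas => r.
rewrite !clipE /over; [|lra|lra].
by case: (leP r 0) => r1; case: (leP r (2 * x)) => r2;
  case: (leP r x) => r3 //=; lra.
Qed.

Lemma trunc_moment2E x : 0 < x ->
  trunc_moment 2 x = clip_moment 2 x - sq_tail x.
Proof.
move=> x0; rewrite /sq_tail /tail /clip_moment -!ExpZ -?ExpB; auto 10 with bmeas.
congr Exp; apply/funext => r; rewrite clipE /over /trunc_at; last lra.
by case: (leP r 0) => r1 /=; case: (leP r x) => r2 /=; lra.
Qed.

(** Up to e x one has r^4 <= (e x)^2 r^2, and between e x and x one has r^4 <= x^2 r^2. *)
Lemma trunc_moment4_le x e : 0 < x -> 0 < e -> e <= 1 ->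
  trunc_moment 4 x <= e ^+ 2 * (x ^+ 2 * trunc_moment 2 x) +
    x ^+ 2 * (trunc_moment 2 x - trunc_moment 2 (e * x)).
Proof.
move=> x0 e0 e1; rewrite /trunc_moment -ExpB -?ExpZ -?ExpD; auto 10 with bmeas.
apply: Exp_le; auto 10 with bmeas => r.
rewrite /trunc_at; have ex : e * x <= x by nra.
case: (leP r 0) => r1 /=; first by rewrite !expr0n !(mulr0,subr0,addr0).
case: (leP r x) => r2 /=; last first.
  by rewrite [r <= _]leNgt (le_lt_trans ex r2)/= !expr0n !(mulr0,subr0,addr0).
rewrite (_ : r ^+ 4 = r ^+ 2 * r ^+ 2); last by rewrite -exprD.
have r20 : 0 <= r ^+ 2 by exact: sqr_ge0.
case: (leP r (e * x)) => r3.
  have le1 : r ^+ 2 <= (e * x) ^+ 2 by rewrite ler_sqr ?nnegrE; nra.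
  rewrite subrr mulr0 addr0.
  have -> : e ^+ 2 * (x ^+ 2 * r ^+ 2) = (e * x) ^+ 2 * r ^+ 2 by ring.
  by rewrite ler_wpM2r.
rewrite expr0n subr0 -[leLHS]add0r lerD//.
  by apply: mulr_ge0; [|apply: mulr_ge0]; exact: sqr_ge0.
by rewrite ler_wpM2r// ler_sqr ?nnegrE; lra.
Qed.

End truncated_moments.

(** * Slow variation of the truncated second moment *)

Lemma cvgr_scale_pinfty (R : realType) (lam : R) :
  0 < lam -> lam * x @[x --> +oo] --> +oo.
Proof. by move=> lam0; exact: gt0_cvgMry. Qed.

Section truncated_moments_asymptotics.
Context d (T : measurableType d) (R : realType) (P : probability T R).
Variable X : {RV P >-> R}.

Local Notation H := (tail X).
Local Notation h := (sq_tail X).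
Local Notation K := (clip_moment X 2).
Local Notation G := (trunc_moment X 2).

Hypothesis h_scale : forall lam : R, 0 < lam ->
  h (lam * x) / h x @[x --> +oo] --> (1 : R).
Hypothesis K_pinfty : K x @[x --> +oo] --> +oo.

(** Where h vanishes, h(1 x) / h(x) is 0 by the convention 0^-1 = 0; its convergence to 1 therefore
    keeps h away from 0 near infinity. *)
Lemma tail_near_gt0 : \forall x \near +oo, 0 < h x.
Proof.
near=> x; rewrite lt_neqAle mulr_ge0 ?sqr_ge0 ?tail_ge0// andbT eq_sym.
have : h (1 * x) / h x != 0.
  by near: x; apply: cvgr_neq0 (oner_neq0 R); exact: h_scale.
by rewrite mulf_eq0 negb_or invr_eq0 => /andP[].
Unshelve. all: by end_near. Qed.

Lemma clip_moment2_near_gt0 : \forall x \near +oo, 0 < K x.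
Proof. exact: cvgry_gt. Qed.

(* Each halving of x costs about 3/4 h(x) since h varies slowly. *)
Lemma tail_le_clip_moment2 m :
  \forall x \near +oo, m%:R / 2 * h x <= K x.
Proof.
have V1 : (2 : R)^-1 * x @[x --> +oo] --> +oo.
  by apply: cvgr_scale_pinfty; rewrite invr_gt0.
elim: m => [|m IH].
  by near=> x; rewrite !mul0r; apply: Exp_ge0 => r; exact: sqr_ge0.
have IH2 : \forall x \near +oo, m%:R / 2 * h (2^-1 * x) <= K (2^-1 * x).
  exact: (V1 _ IH).
(* The induction gains 3 / 4 and needs 1 / 2, so the loss m e / 2 caused by replacing h(x / 2) with
   (1 - e) h(x) may reach 1 / 4; the tolerance e = 1 / (2 (m + 1)) guarantees this. *)
have d0 : (0 : R) < (2 * m.+1%:R)^-1 by rewrite invr_gt0 mulr_gt0.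
near=> x.
have x0 : 0 < x by near: x; exact: nbhs_pinfty_gt.
have hx : 0 < h x by near: x; exact: tail_near_gt0.
have := clip_moment2_half X x0; rewrite mulrC (mulrC x) => K1.
have K2 : m%:R / 2 * h (2^-1 * x) <= K (2^-1 * x) by near: x.
have : `|1 - h (2^-1 * x) / h x| < (2 * m.+1%:R)^-1.
  by near: x; apply: cvgr_dist_lt d0; apply: h_scale; rewrite invr_gt0.
rewrite ltr_norml => /andP[_]; rewrite ltrBlDr -ltrBlDl ltr_pdivlMr// => h1; rewrite mulrBl mul1r in h1.
have m1 : m%:R * (2 * m.+1%:R)^-1 <= (2^-1 : R).
  by rewrite ler_pdivrMr ?mulr_gt0// mulrA mulVf// mul1r ler_nat.
have := @ler0n R m.
move: (h (2^-1 * x)) (h x) h1 hx K1 K2 m1 => u v.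
rewrite -(natr1 m).
move: (2 * (m%:R + 1 : R))^-1 => e.
move: (K x) (K (2^-1 * x)) (m%:R : R) => kx k2 n.
move=> h1 v0 K1 K2 en n0.
have : n / 2 * (v - e * v) <= n / 2 * u by apply: ler_wpM2l; [exact: divr_ge0|exact: ltW].
have : n * e * v <= 2^-1 * v by apply: ler_wpM2r => //; exact: ltW.
by lra.
Unshelve. all: by end_near. Qed.

Lemma tail_clip_moment2_cvg0 : h x / K x @[x --> +oo] --> (0 : R).
Proof.
apply/cvgr0Pnorm_le => e e0; near=> x.
have K0 : 0 < K x by near: x; exact: clip_moment2_near_gt0.
have hx : 0 < h x by near: x; exact: tail_near_gt0.
rewrite ger0_norm; last by apply: divr_ge0; exact: ltW.
rewrite ler_pdivrMr//.
pose m := Num.bound (2 / e).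
have hK : m%:R / 2 * h x <= K x by near: x; exact: tail_le_clip_moment2.
have me : 2 / e < m%:R by apply: archi_boundP; rewrite divr_ge0// ltW.
have {}me : 1 <= e * (m%:R / 2) by move: me; rewrite ltr_pdivrMr//; lra.
rewrite (le_trans _ (ler_wpM2l (ltW e0) hK))// mulrA ler_peMl// ltW//.
Unshelve. all: by end_near. Qed.

(** The ratio is squeezed between 1, by monotonicity of K, and 1 + lam^2 h / K, by
    [clip_moment2_scale]. *)
Let K_scale_ge1 (lam : R) : 1 <= lam ->
  K (lam * x) / K x @[x --> +oo] --> (1 : R).
Proof.
move=> lam1.
apply: (@squeeze_cvgr _ _ _ _ (fun=> 1) (fun x => 1 + lam ^+ 2 * (h x / K x))).
- near=> x.
  have x0 : 0 < x by near: x; exact: nbhs_pinfty_gt.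
  have K0 : 0 < K x by near: x; exact: clip_moment2_near_gt0.
  have lx : x <= lam * x by rewrite ler_peMl// ltW.
  rewrite ler_pdivlMr// mul1r (clip_moment_nondecreasing _ _ (ltW x0) lx)/=.
  rewrite ler_pdivrMr// mulrDl mul1r -[X in _ + X]mulrA divfK ?gt_eqF//.
  exact: clip_moment2_scale.
- exact: cvg_cst.
- rewrite -[X in _ --> X]addr0 -[X in _ + X](mulr0 (lam ^+ 2)).
  apply: cvgD; first exact: cvg_cst.
  by apply: cvgM; [exact: cvg_cst|exact: tail_clip_moment2_cvg0].
Unshelve. all: by end_near. Qed.

Lemma clip_moment2_scale_cvg (lam : R) : 0 < lam ->
  K (lam * x) / K x @[x --> +oo] --> (1 : R).
Proof.
move=> lam0; have [/K_scale_ge1//|lam1] := leP 1 lam.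
(* For lam < 1 the ratio is the inverse of the one for lam^-1 > 1, taken at the point lam x. *)
have L : K (lam^-1 * (lam * x)) / K (lam * x) @[x --> +oo] --> (1 : R).
  have V1 := cvgr_scale_pinfty lam0.
  apply: (@cvg_comp _ _ _ (fun x => lam * x)
    (fun x => K (lam^-1 * x) / K x) _ _ _ V1).
  by apply: K_scale_ge1; rewrite invf_ge1// ltW.
have L' : (K (lam^-1 * (lam * x)) / K (lam * x))^-1 @[x --> +oo] --> (1 : R)^-1.
  by apply: cvgV.
rewrite invr1 in L'.
apply: (cvg_near_eq L'); near=> x.
by rewrite invf_div mulKf// gt_eqF.
Unshelve. all: by end_near. Qed.

Lemma trunc_moment2_cvg : G x / K x @[x --> +oo] --> (1 : R).
Proof.
have L : 1 - h x / K x @[x --> +oo] --> (1 : R) - 0.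
  by apply: cvgB; [exact: cvg_cst|exact: tail_clip_moment2_cvg0].
rewrite subr0 in L; apply: (cvg_near_eq L); near=> x.
have K0 : 0 < K x by near: x; exact: clip_moment2_near_gt0.
have x0 : 0 < x by near: x; exact: nbhs_pinfty_gt.
by rewrite trunc_moment2E// mulrBl divff// gt_eqF.
Unshelve. all: by end_near. Qed.

(** For each fixed c, [trunc_moment4_le] bounds the ratio by c^2 G(x) / K(x) + (G(x) - G(c x)) /
    K(x). Slow variation removes the second term, and c^2 is arbitrarily small. *)
Lemma trunc_moment4_cvg0 :
  trunc_moment X 4 x / (x ^+ 2 * K x) @[x --> +oo] --> (0 : R).
Proof.
have LG (e : R) : 0 < e -> G (e * x) / K x @[x --> +oo] --> (1 : R).
  move=> e0.
  have L : G (e * x) / K (e * x) * (K (e * x) / K x) @[x --> +oo] --> (1 * 1 : R).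
    apply: cvgM; last exact: clip_moment2_scale_cvg.
    exact: (@cvg_comp _ _ _ (fun x => e * x) (fun x => G x / K x) _ _ _
      (cvgr_scale_pinfty e0) trunc_moment2_cvg).
  rewrite mulr1 in L; apply: (cvg_near_eq L); near=> x.
  have K0 : 0 < K (e * x).
    by near: x; exact: (cvgr_scale_pinfty e0 clip_moment2_near_gt0).
  by rewrite mulrA mulfVK// gt_eqF.
have L (e : R) : 0 < e -> e ^+ 2 * (G x / K x) + (G x / K x - G (e * x) / K x)
    @[x --> +oo] --> e ^+ 2 * 1 + (1 - 1).
  move=> e0; apply: cvgD.
    by apply: cvgM; [exact: cvg_cst|exact: trunc_moment2_cvg].
  by apply: cvgB; [exact: trunc_moment2_cvg|exact: LG].
apply/cvgr0Pnorm_lt => e e0.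
(* With this choice c^2 <= c <= e / 2 < e. *)
pose c := Num.min 1 (e / 2).
have c0 : 0 < c by rewrite /c lt_min ltr01/= divr_gt0.
have c1 : c <= 1 by rewrite /c ge_min lexx.
have ce : c ^+ 2 < e.
  have : c <= e / 2 by rewrite /c ge_min lexx orbT.
  by move: c0 c1; nra.
have {}L := L _ c0; rewrite subrr addr0 mulr1 in L.
near=> x.
have x0 : 0 < x by near: x; exact: nbhs_pinfty_gt.
have K0 : 0 < K x by near: x; exact: clip_moment2_near_gt0.
have x2K : 0 < x ^+ 2 * K x by rewrite mulr_gt0// exprn_gt0.
rewrite ger0_norm; last first.
  apply: divr_ge0; last exact: ltW.
  apply: Exp_ge0 => r; rewrite (_ : 4%N = (2 * 2)%N)// exprM; exact: sqr_ge0.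
have Le : c ^+ 2 * (G x / K x) + (G x / K x - G (c * x) / K x) < e.
  by near: x; exact: (cvgr_lt _ L).
apply: le_lt_trans Le; rewrite ler_pdivrMr//.
rewrite (le_trans (trunc_moment4_le X x0 c0 c1))//.
rewrite le_eqVlt; apply/orP; left; apply/eqP; field.
exact: lt0r_neq0.
Unshelve. all: by end_near. Qed.

End truncated_moments_asymptotics.

(** * Finite mean and infinite second moment of X *)

Section moments_of_positive_variable.
Context d (T : measurableType d) (R : realType) (P : probability T R).
Variable X : {RV P >-> R}.
Hypothesis X_gt0 : P [set w | 0 < X w] = 1%E.

Let measurable_comp (f : R -> R) : measurable_fun [set: R] f ->
  measurable_fun [set: T] (fun w => (f (X w))%:E).
Proof.
by move=> mf; apply/measurable_EFinP; exact: (measurableT_comp mf).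
Qed.

Lemma measurable_gt x : measurable [set w | x < X w].
Proof.
have := measurable_funP X measurableT _ (measurable_itv `]x, +oo[).
rewrite setTI; congr (measurable _); apply/seteqP.
by split=> w /=; rewrite in_itv/= andbT.
Qed.

Lemma ae_positive : {ae P, forall w, 0 < X w}.
Proof.
exists (~` [set w | 0 < X w]); split.
- by apply: measurableC; exact: measurable_gt.
- by rewrite probability_setC ?X_gt0 ?subee//; exact: measurable_gt.
- by apply: subsetC => w.
Qed.

Lemma eq_integral_positive (f g : R -> R) :
  measurable_fun [set: R] f -> measurable_fun [set: R] g ->
  (forall r, 0 < r -> f r = g r) ->
  (\int[P]_w (f (X w))%:E = \int[P]_w (g (X w))%:E)%E.
Proof.
move=> mf mg fg; apply: ae_eq_integral => //; try exact: measurable_comp.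
have [N [mN N0 subN]] := ae_positive.
exists N; split => //; apply: subset_trans subN; apply: subsetC => w /= w0 _.
by rewrite fg.
Qed.

Lemma tail_ccdf x : (tail X x)%:E = ccdf X x.
Proof.
rewrite /tail -Exp_EFin; last exact: bounded_measurable_over.
rewrite (_ : (fun w => _) = fun w => (\1_[set w | x < X w] w)%:E).
  rewrite integral_indic//; last exact: measurable_gt.
  rewrite setIT /ccdf /distribution /pushforward.
  by congr (P _); apply/seteqP; split=> w /=; rewrite in_itv/= andbT.
by apply/funext => w; rewrite /over indicE mem_setE.
Qed.

Lemma tail_cdf x : tail X x = 1 - fine (cdf X x).
Proof.
apply: EFin_inj; rewrite tail_ccdf ccdf_1_cdf EFinB fineK//.
exact: fin_num_measure.
Qed.

(** Monotone convergence; the positive part is the pointwise limit of the cutoffs at every sample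
    point, including those of the null set where X <= 0. *)
Lemma clip_moment_cvg_integral n (u : nat -> R) : (forall k, 0 <= u k) ->
  {homo u : k l / (k <= l)%N >-> k <= l} -> u k @[k --> \oo] --> +oo ->
  (clip_moment X n (u k))%:E @[k --> \oo] -->
    (\int[P]_w (Num.max 0 (X w) ^+ n)%:E)%E.
Proof.
move=> u0 und uy.
have -> : (fun k => (clip_moment X n (u k))%:E) =
    (fun k => \int[P]_w (clip (u k) (X w) ^+ n)%:E)%E.
  apply/funext => k; rewrite -(Exp_EFin X)//.
  by apply: bounded_measurableX; exact: bounded_measurable_clip.
have -> : (\int[P]_w (Num.max 0 (X w) ^+ n)%:E =
    \int[P]_w limn (fun k => (clip (u k) (X w) ^+ n)%:E))%E.
  apply: eq_integral => w _; apply/esym/cvg_lim => //.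
  apply: cvg_near_cst; near=> k; rewrite /clip.
  have uk : X w <= u k by near: k; exact: cvgry_ge.
  by rewrite min_l.
have clip_ge0 (x r : R) : 0 <= clip x r by rewrite /clip le_max lexx.
apply: (@cvg_monotone_convergence _ _ _ P setT measurableT
  (fun k w => (clip (u k) (X w) ^+ n)%:E)).
- move=> k; apply: (measurable_comp (f := fun r => clip (u k) r ^+ n)).
  by case: (bounded_measurableX n (bounded_measurable_clip (u k))).
- by move=> k w _; rewrite lee_fin exprn_ge0.
- move=> w _ k l kl; rewrite lee_fin lerXn2r ?nnegrE// /clip.
  have ukl := und _ _ kl.
  rewrite ge_max le_max lexx/= le_max; apply/orP.
  by case: (leP (Num.min (X w) (u k)) 0) => ?; [left|right];
    rewrite // le_min !ge_min lexx ukl orbT.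
Unshelve. all: by end_near. Qed.

End moments_of_positive_variable.

Section moments_of_pareto_variable.
Context d (T : measurableType d) (R : realType) (P : probability T R).
Variable X : {RV P >-> R}.
Hypothesis X_gt0 : P [set w | 0 < X w] = 1%E.

Lemma mu_positive_part n :
  mu_ X n.+1%:R = (\int[P]_w (Num.max 0 (X w) ^+ n.+1)%:E)%E.
Proof.
rewrite /mu_ unlock.
apply: (eq_integral_positive X_gt0 (f := fun r => r `^ n.+1%:R)
  (g := fun r => Num.max 0 r ^+ n.+1)).
- exact: measurable_powR.
- by apply: measurable_funX; exact: measurable_maxr.
- by move=> r r0; rewrite powR_mulrn ?ltW// max_r// ltW.
Qed.

Lemma clip_moment2_pinfty : mu_ X 2 = +oo%E ->
  clip_moment X 2 x @[x --> +oo] --> +oo.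
Proof.
rewrite (mu_positive_part 1) => mu2.
have L : clip_moment X 2 n%:R @[n --> \oo] --> +oo.
  apply/cvgeryP; rewrite -mu2; apply: (clip_moment_cvg_integral (u := fun n => n%:R)).
  - by move=> k; exact: ler0n.
  - by move=> k l kl; rewrite ler_nat.
  - exact: cvgr_idn.
apply/cvgryPge => A.
have [n _ /(_ n (leqnn n)) An] := cvgry_ge L A.
near=> x; apply: (le_trans An); exact: clip_moment_nondecreasing.
Unshelve. all: by end_near. Qed.

Hypothesis h_scale : forall lam : R, 0 < lam ->
  sq_tail X (lam * x) / sq_tail X x @[x --> +oo] --> (1 : R).

(** Slow variation of x^2 H(x) makes H(x) / H(2 x) tend to 4. Any factor above 2 would do: it makes
    2 x H(2 x) a definite fraction of x H(x), so that the tail is summable along a doubling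
    sequence. *)
Let doubling_tail : \forall x \near +oo, 3 * tail X (2 * x) <= tail X x.
Proof.
near=> x.
have x0 : 0 < x by near: x; exact: nbhs_pinfty_gt.
have h0 : 0 < sq_tail X x by near: x; exact: tail_near_gt0.
have : sq_tail X (2 * x) / sq_tail X x < 4 / 3.
  by near: x; apply: cvgr_lt (h_scale _) _ _ => //; lra.
rewrite ltr_pdivrMr// /sq_tail => e.
have x20 : 0 < x ^+ 2 by exact: exprn_gt0.
have : x ^+ 2 * (3 * tail X (2 * x)) < x ^+ 2 * tail X x.
  by move: e; rewrite exprMn; lra.
by rewrite ltr_pM2l// => /ltW.
Unshelve. all: by end_near. Qed.

(* [clip_moment 1 x + 3 x P(X > x)] does not increase when x is doubled. *)
Lemma clip_moment1_bounded : exists C : R, forall n, clip_moment X 1 n%:R <= C.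
Proof.
have [x1 [_ tail2]] := doubling_tail.
pose x0 := Num.max 1 (x1 + 1).
have x01 : 1 <= x0 by rewrite le_max lexx.
have x0x1 : x1 < x0 by rewrite lt_max ltrDl ltr01 orbT.
(* Doubling x adds at most x H(x) to the first term, and 6 x H(2 x) <= 2 x H(x) bounds the new
   second term; their sum is the old second term 3 x H(x), which is why the coefficient is 3. *)
pose Phi x := clip_moment X 1 x + 3 * (x * tail X x).
have Phi2 x : x0 <= x -> Phi (2 * x) <= Phi x.
  move=> x0x; have xgt0 : 0 < x by lra.
  have := tail2 x (lt_le_trans x0x1 x0x).
  have := clip_moment1_double X xgt0; rewrite /Phi.
  move: (clip_moment X 1 _) (clip_moment X 1 _) (tail X _) (tail X _).
  by move=> l2 l1 t2 t1; nra.
have Phin n : Phi (2 ^+ n * x0) <= Phi x0.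
  elim: n => [|n IH]; first by rewrite expr0 mul1r.
  rewrite exprS -mulrA (le_trans (Phi2 _ _))// ler_peMl//; first lra.
  by rewrite exprn_ege1// ler1n.
exists (Phi x0) => n; apply: le_trans (Phin n).
rewrite /Phi -[leLHS]addr0 lerD//; last first.
  rewrite !mulr_ge0 ?tail_ge0// ?exprn_ge0//; lra.
apply: clip_moment_nondecreasing => //.
rewrite -[leLHS]mulr1 ler_pM// -natrX ler_nat; exact/ltnW/ltn_expl.
Unshelve. all: by end_near. Qed.

(** The uniform bound on the clipped means passes to the monotone limit. Thus mu_1 is finite, and
    the positive part of X is available as a dominating function. *)
Lemma integrable_positive_part :
  P.-integrable [set: T] (fun w => (Num.max 0 (X w))%:E).
Proof.
have [C LC] := clip_moment1_bounded.
apply/integrableP; split.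
  by apply/measurable_EFinP; apply: measurable_maxr.
apply: (@le_lt_trans _ _ C%:E); last exact: ltry.
rewrite (_ : (\int[P]_w _ = \int[P]_w (Num.max 0 (X w) ^+ 1)%:E)%E); last first.
  by apply: eq_integral => w _; rewrite expr1 gee0_abs// lee_fin le_max lexx.
have := @clip_moment_cvg_integral _ _ _ _ X 1 (fun n => n%:R).
move=> /(_ (ler0n R)) L.
apply: (cvge_le _ (L _ _)).
- by near=> n; rewrite lee_fin.
- by move=> k l kl; rewrite ler_nat.
- exact: cvgr_idn.
Unshelve. all: by end_near. Qed.

(** Dominated convergence for a real parameter, obtained by testing along all sequences that tend to
    infinity. *)
Lemma Exp_dominated_cvg (f : R -> R -> R) (g : R -> R) :
  (forall x, bounded_measurable (f x)) -> measurable_fun [set: R] g ->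
  (forall x r, `|f x r| <= Num.max 0 r) ->
  (forall r, f x r @[x --> +oo] --> g r) ->
  Exp X (f x) @[x --> +oo] --> Exp X g.
Proof.
move=> bf mg dom fg; apply/cvg_pinftyP => u uy.
have [] := @dominated_convergence _ _ _ P _ measurableT
  (fun n w => (f (u n) (X w))%:E) (fun w => (g (X w))%:E)
  (fun w => (Num.max 0 (X w))%:E).
- move=> n; apply/measurable_EFinP; apply: (measurableT_comp (f := f (u n))) => //.
  by case: (bf (u n)).
- by apply/measurable_EFinP; apply: (measurableT_comp (f := g)).
- apply/aeW => w _; apply: cvg_EFin; first by near=> n.
  exact: (@cvg_comp _ _ _ u (fun x => f x (X w)) _ _ _ uy (fg _)).
- exact: integrable_positive_part.
- by apply/aeW => w n _; rewrite lee_fin.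
move=> ig _ L; apply: fine_cvg.
rewrite [X in _ --> X]fineK; last exact: integrable_fin_num.
exact: L.
Unshelve. all: by end_near. Qed.

Lemma Exp_positive_part : Exp X (fun r => Num.max 0 r) = fine (mu_ X 1).
Proof.
by rewrite (mu_positive_part 0).
Qed.

Lemma trunc_moment1_cvg :
  trunc_moment X 1 x @[x --> +oo] --> fine (mu_ X 1).
Proof.
rewrite -Exp_positive_part; apply: Exp_dominated_cvg.
- by move=> x; apply: bounded_measurableX; exact: bounded_measurable_trunc_at.
- exact: measurable_maxr.
- move=> x r; rewrite expr1 /trunc_at; case: ifPn => [/andP[r0 _]|_].
    by rewrite max_r; [rewrite gtr0_norm|exact: ltW].
  by rewrite normr0 le_max lexx.
- move=> r; apply: cvg_near_cst; near=> x.
  have rx : r <= x by near: x; exact: nbhs_pinfty_ge (num_real r).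
  by rewrite expr1 /trunc_at rx andbT; case: ltP.
Unshelve. all: by end_near. Qed.

(** For r > 0, min(r, x)^2 / x is at most r and tends to 0, so domination by X applies. This is the
    input that makes the variance of the truncated sample mean vanish. *)
Lemma clip_moment2_div_cvg0 : clip_moment X 2 x / x @[x --> +oo] --> (0 : R).
Proof.
have L : Exp X (fun r => x^-1 * clip x r ^+ 2) @[x --> +oo] --> Exp X (fun=> 0).
  apply: Exp_dominated_cvg => //.
  - by move=> x; auto with bmeas.
  - move=> x r; have [x0|x0] := leP x 0.
      rewrite (_ : clip x r = 0) ?expr0n ?mulr0 ?normr0 ?le_max ?lexx//.
      by rewrite /clip max_l// ge_min x0 orbT.
    rewrite (clipE _ (ltW x0)); case: (leP r 0) => r0.
      by rewrite expr0n mulr0 normr0.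
    have c0 : 0 <= (if r <= x then r else x) <= x.
      by case: (leP r x) => rx; apply/andP; split; lra.
    have c1 : (if r <= x then r else x) <= r by case: (leP r x) => // /ltW.
    move: (if r <= x then r else x) c0 c1 => c /andP[c0 cx] cr.
    rewrite ger0_norm; last by rewrite mulr_ge0 ?sqr_ge0 ?invr_ge0 ?(ltW x0).
    by rewrite ler_pdivrMl//; nra.
  - move=> r.
    have L1 : x^-1 * (Num.max 0 r) ^+ 2 @[x --> +oo] --> 0 * (Num.max 0 r) ^+ 2.
      apply: cvgM; last exact: cvg_cst.
      by apply: (gtr0_cvgV0 _).2 => //; exact: nbhs_pinfty_gt.
    rewrite mul0r in L1; apply: (cvg_near_eq L1); near=> x.
    have rx : r <= x by near: x; exact: nbhs_pinfty_ge (num_real r).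
    by rewrite /clip min_l.
rewrite Exp_cst in L; apply: (cvg_near_eq L); near=> x.
by rewrite ExpZ 1?mulrC//; auto with bmeas.
Unshelve. all: by end_near. Qed.

End moments_of_pareto_variable.

(** * Primitives, and the clipped second moment as an integral of the tail *)

Section primitive_on_positive_reals.
Context {R : realType}.
Let mu := @lebesgue_measure R.

(** This serves the measurability clause of [slowly_varying]. On ]0, n + 1] the function agrees with
    the continuous primitive of f cut off to that interval, and these intervals exhaust ]0, +oo[. *)
Lemma measurable_primitive (f : R -> R) :
  (forall x, 0 < x -> mu.-integrable `]0, x] (EFin \o f)) ->
  measurable_fun (`]0, +oo[ : set R)
    (fun x => \int[mu]_(u in `]0, x]) f u).
Proof.
move=> intf.
have -> : (`]0, +oo[ : set R)%classic = \bigcup_n `]0, n.+1%:R]%classic.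
  apply/seteqP; split=> [x|x [n _]] /=; rewrite !in_itv/= andbT; last by case/andP.
  move=> x0; exists (Num.bound x) => //=; rewrite in_itv/= x0/=.
  by rewrite ltW// (lt_trans (archi_boundP (ltW x0)))// ltr_nat.
apply/measurable_fun_bigcup => // n; set b : R := n.+1%:R.
have b0 : 0 < b by [].
pose g := f \_ (`]0, b] : set R).
have intg : mu.-integrable `[0, b] (EFin \o g).
  apply: (@integrableS _ _ _ _ setT) => //.
  rewrite /g -restrict_EFin; apply/(integrable_mkcond _ _).1 => //.
  exact: intf.
have := parameterized_integral_continuous (ltW b0) intg.
move/subspace_continuous_measurable_fun => /(_ (measurable_itv _)) mg.
have : measurable_fun (`]0, b] : set R) ((parameterized_integral mu 0)^~ g).
  by apply: measurable_funS mg => //; exact: subset_itv_oc_cc.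
apply: eq_measurable_fun => x /set_mem/=; rewrite in_itv/= => /andP[x0 xb].
rewrite /parameterized_integral /g -Rintegral_mkcondr; congr (Rintegral _ _ _).
apply/seteqP; split=> y /=; rewrite !in_itv/=.
  by case=> /andP[_ ->] /andP[-> _].
by move=> /andP[y0 yx]; split; apply/andP; split => //; [exact: ltW|exact: le_trans xb].
Qed.

Lemma integral_double_itv (c : R) : 0 < c ->
  (\int[mu]_(u in `[0%R, c]) (2 * u)%:E = (c ^+ 2)%:E)%E.
Proof.
move=> c0.
have -> : (c ^+ 2)%:E = ((c ^+ 2)%:E - ((0 : R) ^+ 2)%:E)%E.
  by rewrite expr0n sube0.
have cX : continuous (fun u : R => u ^+ 2) by move=> x; exact: exprn_continuous.
apply: (continuous_FTC2 (F := fun u => u ^+ 2)) => //.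
- apply: continuous_subspaceT => x.
  by apply: cvgM; [exact: cvg_cst|exact: cvg_id].
- split.
  + by move=> x _; exact: exprn_derivable.
  + by apply: cvg_at_right_filter; exact: cX.
  + by apply: cvg_at_left_filter; exact: cX.
- by move=> x _; rewrite exp_derive1 expr1.
Qed.

End primitive_on_positive_reals.

Section clip_moment_as_tail_integral.
Context d (T : measurableType d) (R : realType) (P : probability T R).
Variable X : {RV P >-> R}.
Let mu := @lebesgue_measure R.

(** Layer-cake formula at a single r: the integrand is 2 u between 0 and min(r, x), an empty range
    if r <= 0. Integrating it over the law of X and exchanging the integrals gives K. *)
Let integral_double_clip (x r : R) : 0 < x ->
  (\int[mu]_u (if (u < r)%R then 2 * u * \1_(`]0%R, x]) u else 0)%:E =
   (clip x r ^+ 2)%:E)%E.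
Proof.
move=> x0.
pose D : set R := [set u | 0 < u <= x /\ u < r].
have -> : (fun u => (if u < r then 2 * u * \1_(`]0, x]) u else 0)%:E) =
    (fun u => (2 * u)%:E) \_ D.
  apply/funext => u; rewrite /patch; case: ifPn => ur.
    rewrite indicE; have [uD|uD] := boolP (u \in D).
      by move: uD => /set_mem[ux _]; rewrite mem_set ?mulr1//= in_itv.
    rewrite memNset ?mulr0//= in_itv/= => ux.
    by move/negP: uD; apply; apply/mem_set.
  by rewrite memNset//= => -[_]; apply/negP.
rewrite -integral_mkcond (clipE _ (ltW x0)).
have m2 (D' : set R) : measurable_fun D' (fun u : R => (2 * u)%:E).
  by apply/measurable_EFinP; exact: mulrl_measurable.
case: (leP r 0) => r0.
  rewrite (_ : D = set0) ?integral_set0 ?expr0n//.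
  by apply/seteqP; split=> // u [/andP[u0 _]] ur /=; lra.
case: (leP r x) => rx.
  rewrite (_ : D = `]0, r[%classic); last first.
    apply/seteqP; split=> [u [/andP[u0 ux] ur]|u]/=; rewrite in_itv/=.
      by rewrite u0.
    by move=> /andP[u0 ur]; split => //; rewrite u0/=; lra.
  by rewrite -(integral_itv_bndoo true false)// integral_double_itv.
rewrite (_ : D = `]0, x]%classic); last first.
  apply/seteqP; split=> [u [ux ur]|u]/=; rewrite in_itv//=.
  by move=> /andP[u0 ux]; split; [rewrite u0|lra].
rewrite (integral_itv_bndoo false false)//.
by rewrite -(integral_itv_bndoo true false)// integral_double_itv.
Qed.

Lemma clip_moment2_integral (x : R) : 0 < x ->
  (\int[mu]_(u in `]0%R, x]) (2 * u * tail X u)%:E)%E = (clip_moment X 2 x)%:E.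
Proof.
move=> x0; pose GR := measurableTypeR R.
pose F (p : T * GR) : \bar R :=
  (if (p.2 < X p.1)%R then 2 * p.2 * \1_(`]0%R, x]) p.2 else 0)%:E.
have F0 p : (0 <= F p)%E.
  rewrite lee_fin; case: ifP => // _; rewrite indicE.
  have [|] := boolP (p.2 \in _); last by rewrite mulr0.
  by move=> /set_mem/=; rewrite in_itv/= mulr1 => /andP[? _]; rewrite mulr_ge0// ltW.
have mF : measurable_fun [set: T * GR] F.
  apply/measurable_EFinP; apply: measurable_fun_ifT => //.
  - by apply: measurable_fun_ltr => //; exact: measurableT_comp.
  - apply: measurable_funM; first exact: measurable_funM.
    by apply: (@measurableT_comp _ _ _ _ _ _ (\1_(`]0, x]) : GR -> R) _ snd).
have LHS : (\int[P]_w \int[mu]_u F (w, u) = (clip_moment X 2 x)%:E)%E.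
  rewrite -Exp_EFin; last first.
    by apply: bounded_measurableX; exact: bounded_measurable_clip.
  by apply: eq_integral => w _; rewrite /F/= integral_double_clip.
rewrite -LHS (fubini_tonelli F)// integral_mkcond.
apply: eq_integral => u _; rewrite /patch /F/=.
transitivity (\int[P]_w ((2 * u * \1_(`]0, x]) u) * over u (X w))%:E)%E.
  rewrite (Exp_EFin X (f := fun r => (2 * u * \1_(`]0, x]) u) * over u r)).
    rewrite ExpZ; last exact: bounded_measurable_over.
    by rewrite indicE; case: ifP => _; rewrite ?mulr1 ?mulr0 ?mul0r.
  apply: bounded_measurableM; first exact: bounded_measurable_cst.
  exact: bounded_measurable_over.
by apply: eq_integral => w _; rewrite /over; case: ifP => _; rewrite ?mulr1 ?mulr0.
Qed.

Lemma integrable_tail (x : R) : 0 < x ->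
  mu.-integrable `]0, x] (EFin \o (fun u => u * tail X u)).
Proof.
move=> x0.
have mt : measurable_fun (`]0, x] : set R) (fun u => u * tail X u).
  apply: measurable_funM => //.
  by apply: nonincreasing_measurable => //; exact: tail_nonincreasing.
apply: measurable_bounded_integrable => //.
  have : (lebesgue_measure (`]0%R, x]%classic : set R) < +oo)%E.
    by rewrite lebesgue_measure_itv/=; case: ifP => _; rewrite -?EFinB ltry.
  exact.
exists x; split; first exact: num_real.
move=> y xy u /=; rewrite in_itv/= => /andP[u0 ux].
have t1 : tail X u <= 1.
  rewrite -(Exp_cst X 1); apply: Exp_le.
  - exact: bounded_measurable_over.
  - exact: bounded_measurable_cst.
  - by move=> r; rewrite /over lern1 leq_b1.
have t0 := tail_ge0 X u.
rewrite ger0_norm; last by apply: mulr_ge0 => //; exact: ltW.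
by have := ler_piMr (ltW u0) t1; lra.
Qed.

Lemma clip_moment2_Rintegral (x : R) : 0 < x ->
  \int[mu]_(u in `]0, x]) (u * tail X u) = clip_moment X 2 x / 2.
Proof.
move=> x0; apply: (mulfI (x := 2)) => //.
rewrite -RintegralZl//; last exact: integrable_tail.
rewrite [RHS]mulrC divfK// /Rintegral.
under eq_integral do rewrite mulrA.
by rewrite clip_moment2_integral.
Qed.

End clip_moment_as_tail_integral.

(** * Comparison of [tilde_ell] with the clipped second moment *)

Section pareto_asymptotics.
Context d (T : measurableType d) (R : realType) (P : probability T R).
Variables (X : {RV P >-> R}) (ell : R -> R).
Let mu := @lebesgue_measure R.
Hypothesis X_gt0 : P [set w | 0 < X w] = 1%E.
Hypothesis X_pareto : pareto_type X 2 ell.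
Hypothesis mu2 : mu_ X 2 = +oo%E.

Lemma sq_tail_ell_cvg : sq_tail X x / ell x @[x --> +oo] --> (1 : R).
Proof.
have [_ _ L] := X_pareto; apply: (cvg_near_eq L); near=> x.
have x0 : 0 < x by near: x; exact: nbhs_pinfty_gt.
rewrite -tail_cdf powRN (powR_mulrn 2 (ltW x0)) /sq_tail.
by rewrite invfM invrK mulrCA mulrA.
Unshelve. all: by end_near. Qed.

Lemma sq_tail_scale (lam : R) : 0 < lam ->
  sq_tail X (lam * x) / sq_tail X x @[x --> +oo] --> (1 : R).
Proof.
move=> lam0; have [_ [_ _ sv] _] := X_pareto.
exact: (eqv_cvg1_scale (oner_neq0 R) lam0 sq_tail_ell_cvg (sv _ lam0)).
Qed.

Hypothesis ell_int : forall x : R, 0 < x ->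
  mu.-integrable `]0, x] (fun u => (ell u / u)%:E).

(** The equivalence of ell(u) and u^2 H(u) is recast as an error relative to u H(u), a form that can
    be integrated in u. *)
Let ell_tail_close (e : R) : 0 < e -> \forall u \near +oo,
  `|ell u / u - u * tail X u| <= e * (u * tail X u).
Proof.
move=> e0.
have L : (sq_tail X x / ell x)^-1 @[x --> +oo] --> (1 : R).
  rewrite -[X in _ --> X]invr1; apply: cvgV => //; exact: sq_tail_ell_cvg.
near=> u.
have u0 : 0 < u by near: u; exact: nbhs_pinfty_gt.
have h0 : 0 < sq_tail X u.
  by near: u; exact: tail_near_gt0 sq_tail_scale.
have : `|1 - (sq_tail X u / ell u)^-1| <= e.
  by near: u; apply: cvgr_dist_le L _ e0.
rewrite invf_div => le1.
have -> : ell u / u - u * tail X u = - (1 - ell u / sq_tail X u) * (u * tail X u).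
  move: h0; rewrite /sq_tail => /lt0r_neq0; rewrite mulf_eq0 negb_or => /andP[_ t0].
  by field; rewrite t0 gt_eqF.
rewrite normrM normrN [X in _ * X]ger0_norm.
  by rewrite ler_wpM2r// mulr_ge0 ?tail_ge0// ltW.
by rewrite mulr_ge0 ?tail_ge0// ltW.
Unshelve. all: by end_near. Qed.

(** The two integrands are close only beyond some x0. The difference D of the primitives is
    therefore split there: D(x0) is a constant, negligible against K, and the increment from x0 to x
    is at most e K(x) / 2. *)
Lemma tilde_ell_clip_moment2 :
  tilde_ell ell x / clip_moment X 2 x @[x --> +oo] --> (2^-1 : R).
Proof.
have Ky := clip_moment2_pinfty X_gt0 mu2.
pose D x := \int[mu]_(u in `]0, x]) (ell u / u - u * tail X u).
have DE x : 0 < x -> D x = tilde_ell ell x - clip_moment X 2 x / 2.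
  move=> x0; rewrite /D RintegralB//; last 2 first.
  - exact: ell_int.
  - exact: integrable_tail.
  by rewrite clip_moment2_Rintegral.
apply/cvgrPdist_le => e e0.
have [x1 [_ close]] := ell_tail_close e0.
pose x0 := Num.max 1 (x1 + 1).
have x0_gt0 : 0 < x0 by rewrite lt_max ltr01.
have x0x1 : x1 < x0 by rewrite lt_max ltrDl ltr01 orbT.
near=> x.
have xx0 : x0 < x by near: x; exact: nbhs_pinfty_gt (num_real x0).
have xgt0 : 0 < x := lt_trans x0_gt0 xx0.
have K0 : 0 < clip_moment X 2 x by near: x; exact: cvgry_gt.
(* This makes |D(x0)| at most e K(x) / 2, the other half of the error allowed. *)
have KD : 2 * `|D x0| / e <= clip_moment X 2 x by near: x; exact: cvgry_ge.
have intD : mu.-integrable `]0, x] (EFin \o (fun u => ell u / u - u * tail X u)).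
  have itail := integrable_tail X xgt0.
  exact: (integrableB _ (ell_int xgt0) itail).
have intS f : mu.-integrable `]0, x] f -> mu.-integrable `]x0, x] f.
  apply: integrableS => // u /=; rewrite !in_itv/= => /andP[u0 ->].
  by rewrite (lt_trans x0_gt0).
have DB : `|D x - D x0| <= e * (clip_moment X 2 x / 2).
  rewrite /D (Rintegral_itvB intD) ?bnd_simp ?(ltW xx0) ?(ltW x0_gt0)//.
  apply: le_trans.
    by apply: le_normr_Rintegral => //; exact: (intS _ intD).
  rewrite -clip_moment2_Rintegral//.
  apply: (@le_trans _ _ (\int[mu]_(u in `]x0, x]) (e * (u * tail X u)))).
    apply: le_Rintegral => //.
    - by apply: integrable_norm; exact: (intS _ intD).
    - apply: intS.
      rewrite (_ : EFin \o _ = fun u => (e%:E * (u * tail X u)%:E)%E); last first.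
        by apply/funext => u /=; rewrite EFinM.
      by apply: integrableZl => //; exact: integrable_tail.
    - move=> u /=; rewrite in_itv/= => /andP[u0 _]; apply: close.
      exact: lt_trans u0.
  have itail := integrable_tail X xgt0.
  rewrite RintegralZl//; last exact: (intS _ itail).
  rewrite ler_wpM2l ?(ltW e0)//.
  rewrite -(Rintegral_itvB (x := x0) itail) ?bnd_simp ?(ltW xx0) ?(ltW x0_gt0)//.
  rewrite gerBl; apply: Rintegral_ge0 => u /=; rewrite in_itv/= => /andP[u0 _].
  by rewrite mulr_ge0 ?tail_ge0// ltW.
have -> : 2^-1 - tilde_ell ell x / clip_moment X 2 x =
    - (D x / clip_moment X 2 x).
  by rewrite DE//; field; exact: lt0r_neq0.
rewrite normrN normrM normfV (gtr0_norm K0) ler_pdivrMr//.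
have : `|D x| <= `|D x0| + `|D x - D x0|.
  by rewrite -{1}(subrKC (D x0) (D x)) ler_normD.
move: KD; rewrite ler_pdivrMr// => KD.
move: DB; move: (clip_moment X 2 x) KD => k; move: `|_| `|_| `|_| => p q r.
by lra.
Unshelve. all: by end_near. Qed.

Lemma slowly_varying_tilde_ell : slowly_varying (tilde_ell ell).
Proof.
have K_pinfty := clip_moment2_pinfty X_gt0 mu2.
have L := tilde_ell_clip_moment2.
split.
- exact: measurable_primitive.
- near=> x.
  have K0 : 0 < clip_moment X 2 x by near: x; exact: cvgry_gt.
  have : 0 < tilde_ell ell x / clip_moment X 2 x.
    by near: x; apply: cvgr_gt L _ _; rewrite invr_gt0.
  by rewrite pmulr_lgt0// invr_gt0.
- move=> lam lam0; apply: eqv_cvg1_scale L _ => //.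
  exact: clip_moment2_scale_cvg sq_tail_scale K_pinfty _ lam0.
Unshelve. all: by end_near. Qed.

End pareto_asymptotics.

(** * Weak law for truncated variables *)

Section pairwise_independence.
Context d (T : measurableType d) (R : realType) (P : probability T R).

Definition independent_pair (Y Z : {RV P >-> R}) : Prop :=
  forall A B : set R, measurable A -> measurable B ->
    P (Y @^-1` A `&` Z @^-1` B) = (P (Y @^-1` A) * P (Z @^-1` B))%E.

Lemma mutually_independent_pair (X_ : nat -> {RV P >-> R}) (i j : nat) :
  mutually_independent X_ -> i != j -> independent_pair (X_ i) (X_ j).
Proof.
move=> ind ij A B mA mB.
pose C k := if k == i then A else B.
have Ci : C i = A by rewrite /C eqxx.
have Cj : C j = B by rewrite /C eq_sym (negbTE ij).
have mC k : measurable (C k) by rewrite /C; case: ifP.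
have := ind [fset i; j]%fset C mC.
rewrite big_fsetU1/= ?inE// big_seq_fset1 Ci Cj => <-.
congr (P _); apply/seteqP; split=> [w [Aw Bw] k|w kw].
  by rewrite /= !inE => /orP[/eqP->|/eqP->]; rewrite ?Ci ?Cj.
split; first by rewrite -Ci; apply: kw; rewrite /= !inE eqxx.
by rewrite -Cj; apply: kw; rewrite /= !inE eqxx orbT.
Qed.

Lemma integral_distribution_Exp (Y : {RV P >-> R}) (f : R -> R) :
  bounded_measurable f ->
  (\int[distribution P Y]_y (f y)%:E = (Exp Y f)%:E)%E.
Proof.
move=> bf; rewrite integral_distribution.
- by rewrite -Exp_EFin.
- by apply/measurable_EFinP; case: bf.
- exact: integrable_bounded_comp.
Qed.

(** Independence says that the law of (Y, Z) and the product of the marginal laws agree on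
    rectangles, hence on all measurable sets; Fubini for the product then splits the integral. *)
Lemma Rintegral_independent_pair (Y Z : {RV P >-> R}) (f g : R -> R) :
  independent_pair Y Z -> bounded_measurable f -> bounded_measurable g ->
  \int[P]_w (f (Y w) * g (Z w)) = Exp Y f * Exp Z g.
Proof.
move=> ind bf bg.
pose YZ (w : T) : R * R := (Y w, Z w).
have mYZ : measurable_fun [set: T] YZ by apply: measurable_fun_pair.
pose YZm : {mfun T >-> (R * R)%type} := HB.pack YZ (isMeasurableFun.Build _ _ _ _ YZ mYZ).
pose F (p : R * R) : \bar R := (f p.1 * g p.2)%:E.
have bF : bounded_measurable (fun p : R * R => f p.1 * g p.2).
  apply: bounded_measurableM.
    exact: (bounded_measurable_comp measurable_fst bf).
  exact: (bounded_measurable_comp measurable_snd bg).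
have mF : measurable_fun [set: R * R] F by apply/measurable_EFinP; case: bF.
have law A : measurable A ->
    (distribution P Y \x distribution P Z)%E A = distribution P YZm A.
  apply: product_measure_unique => B C mB mC.
  by rewrite /distribution/= /pushforward -ind.
rewrite /Rintegral -fineM; last 2 first.
- by apply: integrable_fin_num => //; exact: integrable_bounded_comp.
- by apply: integrable_fin_num => //; exact: integrable_bounded_comp.
congr fine.
transitivity (\int[distribution P YZm]_p F p)%E.
  rewrite integral_distribution//.
  exact: (integrable_bounded_measurable P (bounded_measurable_comp mYZ bF)).
have intF : ((distribution P Y \x distribution P Z)%E).-integrable
    [set: R * R] F.
  have [_ [M FM]] := bF.
  apply/integrableP; split => //.
  apply: (@le_lt_trans _ _ (\int[(distribution P Y \x distribution P Z)%E]_p M%:E)%E).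
    apply: ge0_le_integral => //.
    - exact: measurableT_comp.
    - by move=> p _; rewrite lee_fin (le_trans _ (FM p)).
  rewrite integral_cst//=.
  have -> : (distribution P Y \x distribution P Z)%E [set: R * R] = 1%E.
    by rewrite law// probability_setT.
  by rewrite mule1 ltry.
rewrite (eq_measure_integral (distribution P Y \x distribution P Z)%E); last first.
  by move=> A mA _; exact/esym/law.
rewrite -integral12_prod_meas1//.
transitivity (\int[distribution P Y]_y (f y * Exp Z g)%:E)%E.
  apply: eq_integral => y _; rewrite /fubini_F /F/=.
  under eq_integral do rewrite EFinM.
  rewrite integralZl//; last exact: (integrable_bounded_measurable _ bg).
  by rewrite EFinM integral_distribution_Exp.
under [LHS]eq_integral do rewrite EFinM.
rewrite integralZr//; last exact: (integrable_bounded_measurable _ bf).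
by rewrite integral_distribution_Exp// !Exp_EFin.
Qed.

Lemma identically_distributed_Exp (Y Z : {RV P >-> R}) (f : R -> R) :
  identically_distributed Y Z -> bounded_measurable f -> Exp Y f = Exp Z f.
Proof.
move=> YZ bf; apply: EFin_inj; rewrite -!integral_distribution_Exp//.
by apply: eq_measure_integral => A mA _; exact: YZ.
Qed.

End pairwise_independence.

Section weak_law.
Context d (T : measurableType d) (R : realType) (P : probability T R).
Variables (X : {RV P >-> R}) (X_ : nat -> {RV P >-> R}).
Hypothesis X_iid : iid_copies X X_.

Let bcomp (f : R -> R) i : bounded_measurable f ->
  bounded_measurable (fun w => f (X_ i w)).
Proof.
exact: (bounded_measurable_comp (measurable_funP (X_ i))).
Qed.

Let bsum (f : R -> R) n : bounded_measurable f ->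
  bounded_measurable (fun w => \sum_(i < n) f (X_ i w)).
Proof.
move=> bf; elim: n => [|n IH].
  by under eq_fun do rewrite big_ord0; exact: bounded_measurable_cst.
under eq_fun do rewrite big_ord_recr/=.
by apply: bounded_measurableD => //; exact: bcomp.
Qed.

(** Each pair X_i, X_n with i < n is independent and g is centered. The length m is kept apart from
    n so that X_n stays fixed during the induction. *)
Let sum_cross (g : R -> R) m n : bounded_measurable g -> Exp X g = 0 ->
  (m <= n)%N -> \int[P]_w ((\sum_(i < m) g (X_ i w)) * g (X_ n w)) = 0.
Proof.
move=> bg g0; elim: m => [|m IH] mn.
  under eq_Rintegral do rewrite big_ord0 mul0r.
  by rewrite Rintegral_cst// mul0r.
under eq_Rintegral do rewrite big_ord_recr/= mulrDl.
rewrite RintegralD//; last 2 first.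
- apply: integrable_bounded_measurable.
  by apply: bounded_measurableM; [exact: bsum|exact: bcomp].
- apply: integrable_bounded_measurable.
  by apply: bounded_measurableM; exact: bcomp.
rewrite IH ?(ltnW mn)// add0r Rintegral_independent_pair//.
  by rewrite (identically_distributed_Exp (X_iid.2 m) bg) g0 mul0r.
by apply: (mutually_independent_pair X_iid.1); rewrite ltn_eqF.
Qed.

Lemma second_moment_sum (g : R -> R) n : bounded_measurable g -> Exp X g = 0 ->
  \int[P]_w ((\sum_(i < n) g (X_ i w)) ^+ 2) =
  n%:R * Exp X (fun r => g r ^+ 2).
Proof.
move=> bg g0; elim: n => [|n IH].
  under eq_Rintegral do rewrite big_ord0 expr0n.
  by rewrite Rintegral_cst// !mul0r.
under eq_Rintegral do
  rewrite big_ord_recr/= sqrrD -mulrnAr -mulr_natl [X in _ + X + _]mulrCA.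
have iS : P.-integrable setT (EFin \o (fun w => (\sum_(i < n) g (X_ i w)) ^+ 2)).
  by apply: integrable_bounded_measurable; apply: bounded_measurableX; exact: bsum.
have ig : P.-integrable setT (EFin \o (fun w => g (X_ n w) ^+ 2)).
  by apply: integrable_bounded_measurable; apply: bounded_measurableX; exact: bcomp.
have bC : bounded_measurable (fun w => (\sum_(i < n) g (X_ i w)) * g (X_ n w)).
  by apply: bounded_measurableM; [exact: bsum|exact: bcomp].
have iC : P.-integrable setT
    (EFin \o (fun w => 2 * ((\sum_(i < n) g (X_ i w)) * g (X_ n w)))).
  apply: integrable_bounded_measurable; apply: bounded_measurableM => //.
  exact: bounded_measurable_cst.
rewrite RintegralD//; last first.
  apply: integrable_bounded_measurable; apply: bounded_measurableD.
    by apply: bounded_measurableX; exact: bsum.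
  by apply: bounded_measurableM => //; exact: bounded_measurable_cst.
rewrite RintegralD// RintegralZl//; last exact: integrable_bounded_measurable.
rewrite sum_cross// mulr0 addr0 IH -natr1 mulrDl mul1r; congr (_ + _).
apply: (identically_distributed_Exp (f := fun r => g r ^+ 2) (X_iid.2 n)).
exact: bounded_measurableX.
Qed.

(** Chebyshev's inequality, with the variance of f(X) enlarged to its raw second moment: for powers
    of [trunc_at] that is again a truncated moment. *)
Lemma chebyshev_mean (f : R -> R) n (e : R) : bounded_measurable f ->
  (0 < n)%N -> 0 < e ->
  (P [set w | (e <= `|n%:R^-1 * (\sum_(i < n) f (X_ i w)) - Exp X f|)%R]
   <= (Exp X (fun r => f r ^+ 2) / (n%:R * e ^+ 2))%:E)%E.
Proof.
move=> bf n0 e0; set m := Exp X f.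
have n0' : 0 < n%:R :> R by rewrite ltr0n.
pose g r := f r - m.
have bg : bounded_measurable g.
  by apply: bounded_measurableB => //; exact: bounded_measurable_cst.
have g0 : Exp X g = 0.
  by rewrite ExpB ?Exp_cst ?subrr//; exact: bounded_measurable_cst.
have g2 : Exp X (fun r => g r ^+ 2) <= Exp X (fun r => f r ^+ 2).
  have -> : (fun r => g r ^+ 2) = (fun r => f r ^+ 2 - (2 * m * f r - m ^+ 2)).
    by apply/funext => r; rewrite /g; ring.
  have bmf : bounded_measurable (fun r => 2 * m * f r).
    by apply: bounded_measurableM => //; exact: bounded_measurable_cst.
  have bm : bounded_measurable (fun _ : R => m ^+ 2) by exact: bounded_measurable_cst.
  rewrite ExpB//; [|exact: bounded_measurableX|exact: bounded_measurableB].
  rewrite ExpB// Exp_cst ExpZ// -/m gerBl.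
  have : 0 <= m ^+ 2 by exact: sqr_ge0.
  by rewrite (_ : 2 * m * m = 2 * m ^+ 2); [lra|ring].
pose S w := \sum_(i < n) g (X_ i w).
have bS : bounded_measurable S by exact: bsum.
have SE w : n%:R^-1 * (\sum_(i < n) f (X_ i w)) - m = n%:R^-1 * S w.
  rewrite /S /g sumrB sumr_const card_ord mulrBr -[X in _ - _ * X]mulr_natl.
  by rewrite mulKf// gt_eqF.
pose Sm : {RV P >-> R} := HB.pack S (isMeasurableFun.Build _ _ _ _ S bS.1).
have ne0 : 0 < n%:R * e by exact: mulr_gt0.
have := @markov _ _ _ P Sm (fun x => x ^+ 2) _ ne0.
have -> : ('E_P[((fun x : R => x ^+ 2) \o (fun x => `|x|) \o Sm)%R] =
    (n%:R * Exp X (fun r => g r ^+ 2)%R)%:E)%E.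
  rewrite -second_moment_sum// unlock /Rintegral fineK.
    by apply: eq_integral => w _ /=; rewrite real_normK ?num_real.
  apply: integrable_fin_num => //; apply: integrable_bounded_measurable.
  exact: bounded_measurableX.
rewrite -lee_pdivlMl ?exprn_gt0// => mk.
apply: (le_trans (le_trans _ (mk _ _ _))).
- rewrite le_eqVlt; apply/orP; left; apply/eqP; congr (P _).
  apply/funext => w /=; rewrite SE normrM ger0_norm ?invr_ge0 ?ler0n//.
  by rewrite lee_fin ler_pdivlMl.
- exact: exprn_measurable.
- by move=> r _; exact: sqr_ge0.
- by move=> x y; rewrite !nnegrE => x0 y0 xy; rewrite ler_sqr.
- rewrite -EFinM lee_fin ler_pdivlMr ?mulr_gt0 ?exprn_gt0//.
  rewrite (le_trans _ g2)// le_eqVlt; apply/orP; left; apply/eqP.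
  by field; rewrite !gt_eqF.
Qed.

End weak_law.

(** * The sample coefficient of variation at a random index *)

Section measurable_sample_covar.

Lemma measurable_invr (R : realType) : measurable_fun [set: R] (@GRing.inv R).
Proof.
(* Squaring makes the base of the real power nonnegative; at x = 0 both sides are 0. *)
have -> : @GRing.inv R = fun x => x * (x ^+ 2) `^ (-1).
  apply/funext => x; have [->|x0] := eqVneq x 0; first by rewrite invr0 mul0r.
  by rewrite powR_inv1 ?sqr_ge0//; field.
apply: measurable_funM => //.
by apply: (measurableT_comp (measurable_powR _)); exact: exprn_measurable.
Qed.

Lemma measurable_sqrtr (R : realType) : measurable_fun [set: R] (@Num.sqrt R).
Proof. by apply: continuous_measurable_fun; exact: sqrt_continuous. Qed.

Lemma measurable_sample_covar d (T : measurableType d) (R : realType)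
    (Y : nat -> T -> R) n : (forall i, measurable_fun [set: T] (Y i)) ->
  measurable_fun [set: T] (fun w => sample_covar (fun i => Y i w) n).
Proof.
move=> mY.
have mmean : measurable_fun [set: T] (fun w => sample_mean (fun i => Y i w) n).
  by apply: measurable_funM => //; exact: measurable_sum.
apply: measurable_funM.
  apply: (measurableT_comp (@measurable_sqrtr R)).
  apply: measurable_funM => //; apply: measurable_sum => i.
  by apply: measurable_funX; exact: measurable_funB.
exact: (measurableT_comp (@measurable_invr R)).
Qed.

End measurable_sample_covar.

Section real_valued_probability.
Context d (T : measurableType d) (R : realType) (P : probability T R).
Implicit Types A B : set T.

(** Real values allow probability estimates to be closed by linear arithmetic. *)
Definition prob A : R := fine (P A).

Lemma probK A : measurable A -> (prob A)%:E = P A.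
Proof. by move=> mA; rewrite /prob fineK// fin_num_measure. Qed.

Lemma prob_ge0 A : 0 <= prob A.
Proof. by rewrite /prob fine_ge0. Qed.

Lemma prob_le A B : measurable A -> measurable B -> A `<=` B -> prob A <= prob B.
Proof.
move=> mA mB AB; rewrite -lee_fin !probK//.
by apply: le_measure => //; exact: mem_set.
Qed.

Lemma prob_le1 A : measurable A -> prob A <= 1.
Proof. by move=> mA; rewrite -lee_fin probK// probability_le1. Qed.

Lemma probU A B : measurable A -> measurable B ->
  prob (A `|` B) <= prob A + prob B.
Proof.
move=> mA mB; rewrite -lee_fin EFinD !probK//; last exact: measurableU.
exact: measureU2.
Qed.

Lemma probC A : measurable A -> prob (~` A) = 1 - prob A.
Proof.
move=> mA; apply: EFin_inj; rewrite EFinB !probK//; last exact: measurableC.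
by rewrite probability_setC.
Qed.

Lemma prob_sub_bigU (A : set T) (F : nat -> set T) n : measurable A ->
  (forall i, measurable (F i)) ->
  (forall w, A w -> exists2 i, (i < n)%N & F i w) ->
  prob A <= \sum_(i < n) prob (F i).
Proof.
move=> mA mF AF; rewrite -lee_fin probK// -sumEFin.
rewrite (eq_bigr (fun i : 'I_n => P (F i))); last by move=> i _; rewrite probK.
apply: content_subadditive => //.
by move=> w /AF[i ni Fi]; rewrite -bigcup_mkord; exists i.
Qed.

End real_valued_probability.

(** * Truncated moments at the level a_t *)

Section normalizing_sequence.
Context d (T : measurableType d) (R : realType) (P : probability T R).
Variables (X : {RV P >-> R}) (ell a : R -> R).
Hypothesis X_gt0 : P [set w | 0 < X w] = 1%E.
Hypothesis X_pareto : pareto_type X 2 ell.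
Hypothesis mu2 : mu_ X 2 = +oo%E.
Hypothesis ell_int : forall x : R, 0 < x ->
  lebesgue_measure.-integrable `]0, x] (fun u => (ell u / u)%:E).
Hypothesis a_pinfty : a t @[t --> +oo] --> +oo.
Hypothesis a_norm : t * a t ^- 2 * tilde_ell ell (a t) @[t --> +oo] --> (1 : R).

Local Notation K := (clip_moment X 2).
Local Notation G := (trunc_moment X 2).

Let h_scale := sq_tail_scale X_pareto.
Let K_pinfty := clip_moment2_pinfty X_gt0 mu2.

Let along (f : R -> R) (l : R) : f x @[x --> +oo] --> l ->
  f (a t) @[t --> +oo] --> l.
Proof. by move=> fl; exact: (cvg_comp _ _ a_pinfty fl). Qed.

Let a_gt0 : \forall t \near +oo, 0 < a t.
Proof. exact: cvgry_gt. Qed.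

Let K_gt0 : \forall t \near +oo, 0 < K (a t).
Proof. exact: (a_pinfty (cvgry_gt K_pinfty 0)). Qed.

Lemma norm_clip_moment2 : t * a t ^- 2 * K (a t) @[t --> +oo] --> (2 : R).
Proof.
have L : (tilde_ell ell (a t) / K (a t))^-1 @[t --> +oo] --> (2^-1 : R)^-1.
  apply: cvgV; rewrite ?invr_eq0//.
  exact: along (tilde_ell_clip_moment2 X_gt0 X_pareto mu2 ell_int).
have L2 : t * a t ^- 2 * tilde_ell ell (a t) * (tilde_ell ell (a t) / K (a t))^-1
    @[t --> +oo] --> 1 * (2^-1 : R)^-1.
  by apply: cvgM.
rewrite mul1r invrK in L2; apply: (cvg_near_eq L2); near=> t.
have : (tilde_ell ell (a t) / K (a t))^-1 != 0.
  by near: t; apply: cvgr_neq0 L _; rewrite invrK.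
rewrite invr_eq0 mulf_eq0 negb_or => /andP[t0 k0].
by rewrite invf_div mulrA (mulrAC _ (tilde_ell _ _)) mulfK.
Unshelve. all: by end_near. Qed.

(** As in the neighbouring limits, the quantity is t K(a_t) / a_t^2 times a ratio with known limit,
    here h / K. It bounds, up to a constant, the probability that one of order t variables exceeds
    a_t. *)
Lemma norm_tail_cvg0 : t * tail X (a t) @[t --> +oo] --> (0 : R).
Proof.
have L : t * a t ^- 2 * K (a t) * (sq_tail X (a t) / K (a t))
    @[t --> +oo] --> (2 * 0 : R).
  apply: cvgM; first exact: norm_clip_moment2.
  exact: along (tail_clip_moment2_cvg0 h_scale K_pinfty).
rewrite mulr0 in L; apply: (cvg_near_eq L); near=> t.
have a0 : 0 < a t by near: t.
have k0 : 0 < K (a t) by near: t.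
by rewrite /sq_tail; field; rewrite !gt_eqF.
Unshelve. all: by end_near. Qed.

Lemma norm_trunc_moment2 : t / a t ^+ 2 * G (a t) @[t --> +oo] --> (2 : R).
Proof.
have L : t * a t ^- 2 * K (a t) * (G (a t) / K (a t)) @[t --> +oo] --> (2 * 1 : R).
  apply: cvgM; first exact: norm_clip_moment2.
  exact: along (trunc_moment2_cvg h_scale K_pinfty).
rewrite mulr1 in L; apply: (cvg_near_eq L); near=> t.
have a0 : 0 < a t by near: t.
have k0 : 0 < K (a t) by near: t.
by field; rewrite !gt_eqF.
Unshelve. all: by end_near. Qed.

(** For n of order t, this is the order of the variance bound for t / a_t^2 times the mean of the
    truncated squares. *)
Lemma norm_trunc_moment4 :
  t / a t ^+ 4 * trunc_moment X 4 (a t) @[t --> +oo] --> (0 : R).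
Proof.
have L : t * a t ^- 2 * K (a t) * (trunc_moment X 4 (a t) / (a t ^+ 2 * K (a t)))
    @[t --> +oo] --> (2 * 0 : R).
  apply: cvgM; first exact: norm_clip_moment2.
  exact: (along (f := fun x => trunc_moment X 4 x / (x ^+ 2 * K x))
    (trunc_moment4_cvg0 h_scale K_pinfty)).
rewrite mulr0 in L; apply: (cvg_near_eq L); near=> t.
have a0 : 0 < a t by near: t.
have k0 : 0 < K (a t) by near: t.
by field; rewrite !gt_eqF.
Unshelve. all: by end_near. Qed.

Lemma norm_sq_cvg0 : t / a t ^+ 2 @[t --> +oo] --> (0 : R).
Proof.
have V : (K (a t))^-1 @[t --> +oo] --> (0 : R).
  apply: (gtr0_cvgV0 _).2; first exact: K_gt0.
  exact: (cvg_comp _ _ a_pinfty K_pinfty).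
have L : t * a t ^- 2 * K (a t) * (K (a t))^-1 @[t --> +oo] --> (2 * 0 : R).
  by apply: cvgM => //; exact: norm_clip_moment2.
rewrite mulr0 in L; apply: (cvg_near_eq L); near=> t.
have k0 : 0 < K (a t) by near: t.
by rewrite mulfK// gt_eqF.
Unshelve. all: by end_near. Qed.

(** G / t is the inverse of t K / a_t^2, times (K / a_t)^2, times G / K; the middle factor tends to
    0. For n of order t, this is the order of the variance bound for the truncated sample mean. *)
Lemma trunc_moment2_div_cvg0 : G (a t) / t @[t --> +oo] --> (0 : R).
Proof.
have V : (t * a t ^- 2 * K (a t))^-1 @[t --> +oo] --> (2 : R)^-1.
  by apply: cvgV => //; exact: norm_clip_moment2.
have Ka : K (a t) / a t @[t --> +oo] --> (0 : R).
  exact: (along (f := fun x => K x / x) (clip_moment2_div_cvg0 h_scale)).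
have L : (t * a t ^- 2 * K (a t))^-1 * (K (a t) / a t * (K (a t) / a t))
    * (G (a t) / K (a t)) @[t --> +oo] --> ((2 : R)^-1 * (0 * 0) * 1 : R).
  apply: cvgM; last exact: along (trunc_moment2_cvg h_scale K_pinfty).
  by apply: cvgM => //; exact: cvgM.
rewrite !(mul0r, mulr0) in L; apply: (cvg_near_eq L); near=> t.
have t0 : 0 < t by near: t; exact: nbhs_pinfty_gt.
have a0 : 0 < a t by near: t.
have k0 : 0 < K (a t) by near: t.
by field; rewrite !gt_eqF.
Unshelve. all: by end_near. Qed.

Lemma norm_trunc_moment1 : trunc_moment X 1 (a t) @[t --> +oo] --> fine (mu_ X 1).
Proof. exact: along (trunc_moment1_cvg X_gt0 h_scale). Qed.

(** Since min(r, x)^2 <= x r for r > 0, mu_1 is at least K(x) / x, and K, which tends to infinity,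
    is positive somewhere. *)
Lemma mu1_gt0 : 0 < fine (mu_ X 1).
Proof.
rewrite -(Exp_positive_part X_gt0).
have [x0 [_ Kx0]] := cvgry_gt K_pinfty 0.
pose x := Num.max 1 (x0 + 1).
have x1 : 0 < x by rewrite lt_max ltr01.
have K0 : 0 < K x by apply: (Kx0 x); rewrite lt_max ltrDl ltr01 orbT.
apply: (@lt_le_trans _ _ (x^-1 * K x)); first by rewrite mulr_gt0 ?invr_gt0.
rewrite -ExpZ; last by apply: bounded_measurableX; exact: bounded_measurable_clip.
apply: le_Rintegral => //.
- apply: (integrable_bounded_comp X (f := fun r => x^-1 * clip x r ^+ 2)).
  apply: bounded_measurableM; first exact: bounded_measurable_cst.
  by apply: bounded_measurableX; exact: bounded_measurable_clip.
- exact: integrable_positive_part h_scale.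
- move=> w _; rewrite ler_pdivrMl// (clipE _ (ltW x1)).
  case: (leP (X w) 0) => w0; first by rewrite expr0n mulr0.
  by case: (leP (X w) x) => wx; nra.
Qed.

End normalizing_sequence.

(** * Deviations for a fixed sample size *)

(** S^2 is the mean of the squares minus the squared mean. The factor t / b^2 is distributed so as
    to isolate the quantities with limits 2, 0 and mu_1. *)
Lemma normalized_sample_covarE (R : realType) (x : nat -> R) n (t b : R) :
  (0 < n)%N -> 0 < t -> 0 < b ->
  Num.sqrt t / b * sample_covar x n =
  Num.sqrt (t / b ^+ 2 * (n%:R^-1 * \sum_(i < n) x i ^+ 2)
            - t / b ^+ 2 * sample_mean x n ^+ 2) / sample_mean x n.
Proof.
move=> n0 t0 b0; rewrite /sample_covar mulrA; congr (_ / _).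
have n0' : (n%:R : R) != 0 by rewrite pnatr_eq0 -lt0n.
have -> : Num.sqrt t / b = Num.sqrt (t / b ^+ 2).
  rewrite sqrtrM ?(ltW t0)// sqrtrV ?sqr_ge0// sqrtr_sqr ger0_norm//.
  exact: ltW.
rewrite /sample_sd -sqrtrM; last by rewrite divr_ge0 ?sqr_ge0 ?(ltW t0).
congr Num.sqrt; rewrite -mulrBr; congr (_ * _).
set m := sample_mean x n.
have S1 : \sum_(i < n) x i = n%:R * m by rewrite /m /sample_mean mulVKf.
under eq_bigr do rewrite sqrrB.
rewrite !big_split/= sumr_const card_ord sumrN sumrMnl -mulr_suml S1.
rewrite -mulr_natl -(mulr_natl (m ^+ 2)); field.
exact: n0'.
Qed.

(** Continuity at (2, m0, 0). The radius rho depends on m0 and eta alone, which is the source of the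
    uniformity in n. *)
Lemma covar_functional_continuous (R : realType) (m0 eta : R) :
  0 < m0 -> 0 < eta -> exists2 rho : R, 0 < rho &
  forall q m r, `|q - 2| < rho -> `|m - m0| < rho -> `|r| < rho ->
    `|Num.sqrt (q - r * m ^+ 2) / m - Num.sqrt 2 / m0| < eta.
Proof.
move=> m00 eta0.
pose F (z : R * R * R) := Num.sqrt (z.1.1 - z.2 * z.1.2 ^+ 2) / z.1.2.
have C : F z @[z --> ((2, m0, 0) : R * R * R)] --> Num.sqrt 2 / m0.
  have C1 : z.1 @[z --> ((2, m0, 0) : R * R * R)] --> ((2, m0) : R * R).
    exact: cvg_fst.
  have C11 : z.1.1 @[z --> ((2, m0, 0) : R * R * R)] --> (2 : R).
    by apply: (cvg_comp _ _ C1); exact: cvg_fst.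
  have C12 : z.1.2 @[z --> ((2, m0, 0) : R * R * R)] --> (m0 : R).
    by apply: (cvg_comp _ _ C1); exact: cvg_snd.
  have C2 : z.2 @[z --> ((2, m0, 0) : R * R * R)] --> (0 : R).
    exact: cvg_snd.
  apply: cvgM; last by apply: cvgV => //; rewrite gt_eqF.
  have C3 : z.1.1 - z.2 * z.1.2 ^+ 2 @[z --> ((2, m0, 0) : R * R * R)] -->
      (2 - 0 * (m0 * m0) : R).
    by apply: cvgB => //; apply: cvgM => //; apply: cvgM.
  rewrite mul0r subr0 in C3.
  by apply: (cvg_comp _ _ C3); exact: sqrt_continuous.
have /cvgrPdist_lt /(_ _ eta0) /nbhs_ballP[rho /= rho0 B] := C.
exists rho => // q m r hq hm hr; rewrite distrC.
have := B (q, m, r); rewrite /F/=; apply.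
split; first by split; rewrite /ball/= distrC.
by rewrite /ball/= sub0r normrN.
Qed.

(** [Y] is a family of plain functions, so that the event can be measured both in the sigma-algebra
    of the space and in the one generated by the sample. *)
Definition covar_deviation (T : Type) (R : realType) (Y : nat -> T -> R)
    (s c eta : R) n : set T :=
  [set w | eta <= `|s * sample_covar (fun i => Y i w) n - c|].

Lemma measurable_ge d (T : measurableType d) (R : realType) (f : T -> R) (e : R) :
  measurable_fun [set: T] f -> measurable [set w | e <= f w].
Proof.
move=> mf; have := mf measurableT _ (measurable_itv `[e, +oo[).
rewrite setTI; congr (measurable _); apply/seteqP.
by split=> w /=; rewrite in_itv/= andbT.
Qed.

Lemma measurable_covar_deviation d (T : measurableType d) (R : realType)
    (Y : nat -> T -> R) (s c eta : R) n :
  (forall i, measurable_fun [set: T] (Y i)) ->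
  measurable (covar_deviation Y s c eta n).
Proof.
move=> mY; apply: measurable_ge.
apply: measurableT_comp => //; apply: measurable_funB => //.
by apply: measurable_funM => //; exact: measurable_sample_covar.
Qed.

Section covar_in_probability.
Context d (T : measurableType d) (R : realType) (P : probability T R).
Variables (X : {RV P >-> R}) (X_ : nat -> {RV P >-> R}).
Hypothesis X_gt0 : P [set w | 0 < X w] = 1%E.
Hypothesis X_iid : iid_copies X X_.

(** Nonpositive values count as out of range too, since [trunc_at] discards them; they only add a
    null event. *)
Let out (b : R) i : set T := X_ i @^-1` ~` `]0, b].

Let measurable_out b i : measurable (out b i).
Proof.
have := measurable_funP (X_ i) measurableT _ (measurableC (measurable_itv `]0, b])).
by rewrite setTI.
Qed.

Let prob_out b i : 0 < b -> prob P (out b i) <= tail X b.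
Proof.
move=> b0; rewrite -lee_fin probK// tail_ccdf.
have -> : P (out b i) = P (X @^-1` ~` `]0, b]).
  by apply: X_iid.2; exact: measurableC.
have mgt := measurable_gt X.
apply: (@le_trans _ _ (P ([set w | b < X w] `|` ~` [set w | 0 < X w]))).
  apply: le_measure.
  - apply/mem_set.
    have := measurable_funP X measurableT _ (measurableC (measurable_itv `]0, b])).
    by rewrite setTI.
  - by apply/mem_set; apply: measurableU => //; exact: measurableC.
  - move=> w /=; rewrite in_itv/= => /negP; rewrite negb_and -ltNge.
    by move=> /orP[/negP|]; [right|left].
apply: (le_trans (measureU2 _ _ _)) => //; first exact: measurableC.
have P0 : P (~` [set w | 0 < X w]) = 0%E.
  by rewrite probability_setC// X_gt0 subee.
rewrite [X in (_ + X)%E]P0 adde0 le_eqVlt; apply/orP; left; apply/eqP.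
by rewrite /ccdf /distribution /pushforward; congr (P _);
  apply/seteqP; split=> w /=; rewrite in_itv/= andbT.
Qed.

(** A deviation has three possible causes, one per summand: some X_i falls outside ]0, b], or the
    truncated mean of squares, or the truncated mean, is far from its expectation. Otherwise the
    sums equal their truncated versions, and the triangle inequality spends rho / 2 on randomness
    and rho / 2 on bias. *)
Lemma covar_deviation_bound (t b rho eta : R) n :
  (forall q m r, `|q - 2| < rho -> `|m - fine (mu_ X 1)| < rho -> `|r| < rho ->
    `|Num.sqrt (q - r * m ^+ 2) / m - Num.sqrt 2 / fine (mu_ X 1)| < eta) ->
  (0 < n)%N -> 0 < t -> 0 < b -> 0 < rho ->
  `|t / b ^+ 2 * trunc_moment X 2 b - 2| < rho / 2 ->
  `|trunc_moment X 1 b - fine (mu_ X 1)| < rho / 2 ->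
  `|t / b ^+ 2| < rho ->
  prob P (covar_deviation X_ (Num.sqrt t / b) (Num.sqrt 2 / fine (mu_ X 1)) eta n) <=
  n%:R * tail X b + trunc_moment X 4 b / (n%:R * (rho / 2 * (b ^+ 2 / t)) ^+ 2)
  + trunc_moment X 2 b / (n%:R * (rho / 2) ^+ 2).
Proof.
move=> close n0 t0 b0 rho0 hG2 hG1 hr; set dev := covar_deviation _ _ _ _ _.
(* The mean of squares is later multiplied by t / b^2, so its tolerance rho / 2 is divided by this
   factor beforehand. *)
have e10 : 0 < rho / 2 * (b ^+ 2 / t).
  by rewrite mulr_gt0 ?divr_gt0 ?exprn_gt0.
have e20 : 0 < rho / 2 by rewrite divr_gt0.
have bt := bounded_measurable_trunc_at b.
have bt2 : bounded_measurable (fun r => trunc_at b r ^+ 2).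
  exact: bounded_measurableX.
have C1 := chebyshev_mean X_iid bt2 n0 e10.
have C2 := chebyshev_mean X_iid bt n0 e20.
set E1 := [set w | _] in C1; set E2 := [set w | _] in C2.
have msum (f : R -> R) : measurable_fun [set: R] f ->
    measurable_fun [set: T] (fun w => n%:R^-1 * \sum_(i < n) f (X_ i w)).
  move=> mf; apply: measurable_funM => //; apply: measurable_sum => i.
  exact: measurableT_comp.
have mE (f : R -> R) e c : measurable_fun [set: R] f ->
    measurable [set w | e <= `|n%:R^-1 * (\sum_(i < n) f (X_ i w)) - c|].
  move=> mf; apply: measurable_ge; apply: measurableT_comp => //.
  by apply: measurable_funB => //; exact: msum.
have mE1 : measurable E1 by exact: (mE _ _ _ bt2.1).
have mE2 : measurable E2 by exact: (mE _ _ _ bt.1).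
have mdev : measurable dev by exact: measurable_covar_deviation.
have mE12 : measurable (E1 `|` E2) by exact: measurableU.
have mU : measurable (dev `\` (E1 `|` E2)) by exact: measurableD.
have P1 : prob P E1 <= trunc_moment X 4 b / (n%:R * (rho / 2 * (b ^+ 2 / t)) ^+ 2).
  rewrite -lee_fin probK//; apply: (le_trans C1); rewrite lee_fin.
  rewrite le_eqVlt; apply/orP; left; apply/eqP; congr (_ / _).
  by congr Exp; apply/funext => r; rewrite -exprM.
have P2 : prob P E2 <= trunc_moment X 2 b / (n%:R * (rho / 2) ^+ 2).
  by rewrite -lee_fin probK//; apply: (le_trans C2).
have PU : prob P (dev `\` (E1 `|` E2)) <= n%:R * tail X b.
  apply: (@le_trans _ _ (\sum_(i < n) prob P (out b i))); last first.
    apply: (@le_trans _ _ (\sum_(i < n) tail X b)).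
      by apply: ler_sum => i _; exact: prob_out.
    by rewrite sumr_const card_ord mulr_natl.
  apply: prob_sub_bigU => // w [dw /not_orP[nE1 nE2]].
  apply: contrapT => nout.
  have inb i : (i < n)%N -> 0 < X_ i w <= b.
    move=> ni; apply/negPn/negP => nX; apply: nout; exists i => //=.
    by rewrite /out/= in_itv/=; exact/negP.
  have s1 : \sum_(i < n) trunc_at b (X_ i w) = \sum_(i < n) X_ i w.
    by apply: eq_bigr => i _; rewrite /trunc_at inb.
  have s2 : \sum_(i < n) trunc_at b (X_ i w) ^+ 2 = \sum_(i < n) X_ i w ^+ 2.
    by apply: eq_bigr => i _; rewrite /trunc_at inb.
  move: nE1 nE2 dw => /negP; rewrite -ltNge s2 => nE1 /negP.
  rewrite -ltNge s1 => nE2; rewrite /dev /covar_deviation /=.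
  rewrite normalized_sample_covarE//; apply/negP; rewrite -ltNge.
  apply: close => //.
  - have := ler_distD (t / b ^+ 2 * trunc_moment X 2 b)
      (t / b ^+ 2 * (n%:R^-1 * \sum_(i < n) X_ i w ^+ 2)) 2.
    have : `|t / b ^+ 2 * (n%:R^-1 * \sum_(i < n) X_ i w ^+ 2) -
        t / b ^+ 2 * trunc_moment X 2 b| < rho / 2.
      rewrite -mulrBr normrM gtr0_norm ?divr_gt0 ?exprn_gt0//.
      by rewrite -ltr_pdivlMl ?divr_gt0 ?exprn_gt0// invf_div [X in _ < X]mulrC.
    by lra.
  - have := ler_distD (trunc_moment X 1 b) (n%:R^-1 * \sum_(i < n) X_ i w)
      (fine (mu_ X 1)).
    move: nE2; rewrite /sample_mean (_ : Exp X _ = trunc_moment X 1 b)//.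
    by lra.
apply: (@le_trans _ _ (prob P ((dev `\` (E1 `|` E2)) `|` (E1 `|` E2)))).
  apply: prob_le => //; first exact: measurableU.
  by move=> w dw; have [?|?] := pselect ((E1 `|` E2) w); [right|left].
apply: (le_trans (probU _ _ _)) => //.
have := probU P mE1 mE2; lra.
Qed.

End covar_in_probability.

(** * Deviations at the random sample size *)

Section random_index.
Context d (T : measurableType d) (R : realType) (P : probability T R).
Variables (X_ : nat -> {RV P >-> R}) (N : R -> {RV P >-> nat}).
Hypothesis N_indep : process_independent N X_.

(** [process_independent] speaks of generated sigma-algebras. The measurability of the event is
    therefore redone on [T] equipped with the sigma-algebra generated by [X_]. *)
Lemma covar_deviation_sigma s c eta n :
  sigma_family [set: nat] X_ (covar_deviation X_ s c eta n).
Proof.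
pose G := \bigcup_(i in [set: nat])
  preimage_set_system [set: T] (X_ i : T -> R) measurable.
apply: (@measurable_covar_deviation _ (g_sigma_algebraType G) R
  (fun i => X_ i : T -> R)) => i _ B mB.
apply: sub_sigma_algebra; exists i => //.
by exists B.
Qed.

Lemma measurable_eq_nat t n : measurable [set w | N t w = n].
Proof.
have := measurable_funP (N t) measurableT [set n] I.
by rewrite setTI.
Qed.

Lemma prob_deviation_indep (t s c eta : R) n : 0 <= t ->
  prob P ([set w | N t w = n] `&` covar_deviation X_ s c eta n) =
  prob P [set w | N t w = n] * prob P (covar_deviation X_ s c eta n).
Proof.
move=> t0.
have mN := measurable_eq_nat t n.
have mA : measurable (covar_deviation X_ s c eta n).
  exact: measurable_covar_deviation.
apply: EFin_inj; rewrite EFinM !probK//; last exact: measurableI.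
apply: N_indep; last exact: covar_deviation_sigma.
apply: sub_sigma_algebra; exists t => //.
by exists [set n] => //; rewrite setTI.
Qed.

Lemma sum_prob_eq_nat t B : \sum_(n < B) prob P [set w | N t w = n] <= 1.
Proof.
suff [-> mB] : \sum_(n < B) prob P [set w | N t w = n] = prob P [set w | (N t w < B)%N]
    /\ measurable [set w | (N t w < B)%N] by exact: prob_le1.
elim: B => [|B [IH mB]].
  rewrite big_ord0 (_ : [set w | _] = set0); first by rewrite /prob measure0.
  by apply/seteqP; split=> w.
have SE : [set w | (N t w < B.+1)%N] = [set w | (N t w < B)%N] `|` [set w | N t w = B].
  apply/seteqP; split=> w /=; rewrite ltnS; last by move=> [/ltnW//|->].
  by rewrite leq_eqVlt => /orP[/eqP|]; [right|left].
have mN := measurable_eq_nat t B.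
split; last by rewrite SE; exact: measurableU.
rewrite big_ord_recr/= IH SE; apply: EFin_inj.
rewrite EFinD !probK//; last exact: measurableU.
rewrite measureU//; apply/seteqP; split=> // w /= [+ NB].
by rewrite NB ltnn.
Qed.

Lemma measurable_random_covar (t : R) :
  measurable_fun [set: T] (fun w => CoVar X_ (N t) w).
Proof.
move=> _ B mB; rewrite setTI.
rewrite (_ : _ @^-1` B = \bigcup_n ([set w | N t w = n] `&`
    (fun w => sample_covar (fun i => X_ i w) n) @^-1` B)).
  apply: bigcup_measurable => n _; apply: measurableI.
    exact: measurable_eq_nat.
  have mX i : measurable_fun [set: T] (X_ i) by [].
  have := measurable_sample_covar n mX measurableT mB.
  by rewrite setTI.
apply/seteqP; split=> w /=; first by move=> Bw; exists (N t w).
by rewrite /CoVar => -[n _ [<-]].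
Qed.

(** Unless N(t) / t leaves ]dl, M], only finitely many values n occur. By independence each
    contributes at most P(N(t) = n) e, and these weights sum to at most 1. *)
Lemma prob_random_deviation (t s c eta dl M e : R) : 0 < t -> 0 <= e ->
  (forall n, dl * t <= n%:R -> n%:R <= M * t ->
    prob P (covar_deviation X_ s c eta n) <= e) ->
  prob P [set w | eta <= `|s * CoVar X_ (N t) w - c|] <=
  prob P [set w | (N t w)%:R / t <= dl] +
  (1 - prob P [set w | (N t w)%:R / t <= M]) + e.
Proof.
move=> t0 e0 dev.
set E := [set w | _]; set E1 := [set w | _]; set E2 := [set w | _].
have mN : measurable_fun [set: T] (fun w => (N t w)%:R / t : R).
  apply: measurable_funM => //.
  by apply: (measurableT_comp (f := fun n : nat => n%:R : R)).
have mle (y : R) : measurable [set w | (N t w)%:R / t <= y].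
  by have := mN measurableT _ (measurable_itv `]-oo, y]); rewrite setTI.
have mE1 : measurable E1 := mle dl.
have mE2 : measurable E2 := mle M.
have mE : measurable E.
  apply: measurable_ge; apply: measurableT_comp => //.
  apply: measurable_funB => //; apply: measurable_funM => //.
  exact: measurable_random_covar.
pose F n := [set w | N t w = n] `&` (if (dl * t <= n%:R) && (n%:R <= M * t)
  then covar_deviation X_ s c eta n else set0).
have mF n : measurable (F n).
  apply: measurableI; first exact: measurable_eq_nat.
  by case: ifP => _ //; exact: measurable_covar_deviation.
have mU : measurable (E `\` (E1 `|` ~` E2)).
  by apply: measurableD => //; apply: measurableU => //; exact: measurableC.
pose B := (Num.bound (M * t)).+1.
have PU : prob P (E `\` (E1 `|` ~` E2)) <= e.
  apply: (@le_trans _ _ (\sum_(n < B) prob P (F n))).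
    apply: prob_sub_bigU => // w [Ew /not_orP[nE1 /contrapT E2w]].
    have ltM : (N t w)%:R <= M * t by move: E2w; rewrite /E2/= ler_pdivrMr.
    have gtd : dl * t <= (N t w)%:R.
      by move: nE1; rewrite /E1/= => /negP; rewrite -ltNge ltr_pdivlMr// => /ltW.
    exists (N t w); last by split => //; rewrite gtd ltM.
    rewrite ltnS -(ler_nat R) (le_trans ltM)// ltW// archi_boundP//.
    exact: le_trans ltM.
  apply: (@le_trans _ _ (\sum_(n < B) prob P [set w | N t w = n] * e)).
    apply: ler_sum => n _; rewrite /F; case: ifPn => [/andP[ge le]|_].
      rewrite prob_deviation_indep ?(ltW t0)// ler_wpM2l ?prob_ge0//.
      exact: dev.
    by rewrite setI0 {1}/prob measure0/= mulr_ge0 ?prob_ge0.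
  by rewrite -mulr_suml ler_piMl// sum_prob_eq_nat.
apply: (@le_trans _ _ (prob P ((E1 `|` ~` E2) `|` (E `\` (E1 `|` ~` E2))))).
  apply: prob_le => //.
    apply: measurableU => //; apply: measurableU => //; exact: measurableC.
  by move=> w Ew; have [?|?] := pselect ((E1 `|` ~` E2) w); [left|right].
have mE12 : measurable (E1 `|` ~` E2).
  by apply: measurableU => //; exact: measurableC.
apply: (le_trans (probU _ _ _)) => //.
have := probU P mE1 (measurableC mE2).
by rewrite probC//; move: PU; lra.
Qed.

End random_index.

Section random_covar_in_probability.
Context d (T : measurableType d) (R : realType) (P : probability T R).
Variables (X : {RV P >-> R}) (X_ : nat -> {RV P >-> R}) (N : R -> {RV P >-> nat}).
Variables (ell a : R -> R).
Hypothesis X_gt0 : P [set w | 0 < X w] = 1%E.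
Hypothesis X_iid : iid_copies X X_.
Hypothesis X_pareto : pareto_type X 2 ell.
Hypothesis mu2 : mu_ X 2 = +oo%E.
Hypothesis ell_int : forall x : R, 0 < x ->
  lebesgue_measure.-integrable `]0, x] (fun u => (ell u / u)%:E).
Hypothesis a_pinfty : a t @[t --> +oo] --> +oo.
Hypothesis a_norm : t * a t ^- 2 * tilde_ell ell (a t) @[t --> +oo] --> (1 : R).

Local Notation mu1 := (fine (mu_ X 1)).

(** The first summand of [covar_deviation_bound] grows with n and is bounded through n <= M t; the
    two Chebyshev terms decrease in n and are bounded through n >= dl t. *)
Lemma covar_in_probability (dl M eta e : R) :
  0 < dl -> 0 < M -> 0 < eta -> 0 < e ->
  \forall t \near +oo, forall n, dl * t <= n%:R -> n%:R <= M * t ->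
  prob P (covar_deviation X_ (Num.sqrt t / a t) (Num.sqrt 2 / mu1) eta n) <= e.
Proof.
move=> dl0 M0 eta0 e0.
have m0 : 0 < mu1 := mu1_gt0 X_gt0 X_pareto mu2.
have [rho rho0 close] := covar_functional_continuous m0 eta0.
have rho20 : 0 < rho / 2 by rewrite divr_gt0.
have e30 : 0 < e / 3 by rewrite divr_gt0.
(* The common constant of both Chebyshev terms once n is replaced by dl t. *)
pose C := (dl * (rho / 2) ^+ 2)^-1.
have C0 : 0 < C by rewrite invr_gt0 mulr_gt0// exprn_gt0.
have L1 : M * (t * tail X (a t)) @[t --> +oo] --> (M * 0 : R).
  apply: cvgM; first exact: cvg_cst.
  exact: (norm_tail_cvg0 X_gt0 X_pareto mu2 ell_int a_pinfty a_norm).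
have L2 : C * (t / a t ^+ 4 * trunc_moment X 4 (a t)) @[t --> +oo] --> (C * 0 : R).
  apply: cvgM; first exact: cvg_cst.
  exact: (norm_trunc_moment4 X_gt0 X_pareto mu2 ell_int a_pinfty a_norm).
have L3 : C * (trunc_moment X 2 (a t) / t) @[t --> +oo] --> (C * 0 : R).
  apply: cvgM; first exact: cvg_cst.
  exact: (trunc_moment2_div_cvg0 X_gt0 X_pareto mu2 ell_int a_pinfty a_norm).
rewrite mulr0 in L1; rewrite mulr0 in L2; rewrite mulr0 in L3.
near=> t => n dn nM.
have t0 : 0 < t by near: t; exact: nbhs_pinfty_gt.
have a0 : 0 < a t by near: t; exact: cvgry_gt.
have b1 : M * (t * tail X (a t)) < e / 3 by near: t; exact: (cvgr_lt _ L1).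
have b2 : C * (t / a t ^+ 4 * trunc_moment X 4 (a t)) < e / 3.
  by near: t; exact: (cvgr_lt _ L2).
have b3 : C * (trunc_moment X 2 (a t) / t) < e / 3.
  by near: t; exact: (cvgr_lt _ L3).
have h1 : `|t / a t ^+ 2 * trunc_moment X 2 (a t) - 2| < rho / 2.
  rewrite distrC; near: t; apply: cvgr_dist_lt _ _ _ rho20.
  exact: (norm_trunc_moment2 X_gt0 X_pareto mu2 ell_int a_pinfty a_norm).
have h2 : `|trunc_moment X 1 (a t) - mu1| < rho / 2.
  rewrite distrC; near: t; apply: cvgr_dist_lt _ _ _ rho20.
  exact: (norm_trunc_moment1 X_gt0 X_pareto a_pinfty).
have h3 : `|t / a t ^+ 2| < rho.
  rewrite -[X in `|X|]subr0 distrC; near: t; apply: cvgr_dist_lt _ _ _ rho0.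
  exact: (norm_sq_cvg0 X_gt0 X_pareto mu2 ell_int a_pinfty a_norm).
have n0 : (0 : R) < n%:R by rewrite (lt_le_trans _ dn)// mulr_gt0.
have n0' : (0 < n)%N by rewrite -(ltr0n R).
apply: (le_trans (covar_deviation_bound X_gt0 X_iid close n0' t0 a0 rho0 h1 h2 h3)).
have G_ge0 k : 0 <= trunc_moment X k (a t).
  apply: Exp_ge0 => r; rewrite exprn_ge0// /trunc_at.
  by case: ifP => // /andP[/ltW].
have nt : 1 <= n%:R / (dl * t) by rewrite ler_pdivlMr ?mulr_gt0// mul1r.
have c1 : n%:R * tail X (a t) <= M * (t * tail X (a t)).
  by rewrite mulrA ler_wpM2r// tail_ge0.
have c2 : trunc_moment X 4 (a t) / (n%:R * (rho / 2 * (a t ^+ 2 / t)) ^+ 2) <=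
    C * (t / a t ^+ 4 * trunc_moment X 4 (a t)).
  rewrite ler_pdivrMr; last first.
    by rewrite mulr_gt0// exprn_gt0// mulr_gt0// divr_gt0// exprn_gt0.
  rewrite [leRHS](_ : _ = trunc_moment X 4 (a t) * (n%:R / (dl * t))).
    by rewrite ler_peMr.
  by rewrite /C; field; rewrite !gt_eqF.
have c3 : trunc_moment X 2 (a t) / (n%:R * (rho / 2) ^+ 2) <=
    C * (trunc_moment X 2 (a t) / t).
  rewrite ler_pdivrMr; last by rewrite mulr_gt0// exprn_gt0.
  rewrite [leRHS](_ : _ = trunc_moment X 2 (a t) * (n%:R / (dl * t))).
    by rewrite ler_peMr.
  by rewrite /C; field; rewrite !gt_eqF.
by lra.
Unshelve. all: by end_near. Qed.

End random_covar_in_probability.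

(** * Convergence in distribution *)

Section convergence_of_cdf.
Context d d' (T : measurableType d) (T' : measurableType d') (R : realType).
Variables (P : probability T R) (P' : probability T' R).

Lemma measurable_le_set d0 (T0 : measurableType d0) (f : T0 -> R) (y : R) :
  measurable_fun [set: T0] f -> measurable [set w | f w <= y].
Proof.
by move=> mf; have := mf measurableT _ (measurable_itv `]-oo, y]); rewrite setTI.
Qed.

Lemma prob_le_nondecreasing (Z : T' -> R) (u v : R) :
  measurable_fun [set: T'] Z -> u <= v ->
  prob P' [set w | Z w <= u] <= prob P' [set w | Z w <= v].
Proof.
move=> mZ uv; apply: prob_le; [exact: measurable_le_set|exact: measurable_le_set|].
by move=> w /= /le_trans; apply.
Qed.

(** A monotone function has countably many discontinuities, whereas ]u, v[ has positive Lebesgue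
    measure. *)
Lemma cdf_continuity_dense (Z : T' -> R) (u v : R) :
  measurable_fun [set: T'] Z -> u < v ->
  exists2 x, u < x < v & {for x, continuous (fun y => P' [set w | Z w <= y])}.
Proof.
move=> mZ uv.
pose Zm : {RV P' >-> R} := HB.pack Z (isMeasurableFun.Build _ _ _ _ Z mZ).
have cdfE y : P' [set w | Z w <= y] = cdf Zm y by [].
pose F y := prob P' [set w | Z w <= y].
have ndF : {in `[u, v] &, nondecreasing_fun F}.
  by move=> x y _ _; exact: prob_le_nondecreasing.
have [x [xuv nD]] : exists x, x \in (`]u, v[) /\ ~ discontinuity F x.
  apply: contrapT => nex.
  have sub : `]u, v[%classic `<=` [set x | x \in (`]u, v[) /\ discontinuity F x].
    by move=> x xuv; split => //; apply: contrapT => nD; apply: nex; exists x.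
  have := sub_countable (subset_card_le sub) (discontinuity_countable ndF).
  move/countable_lebesgue_measure0.
  rewrite lebesgue_measure_itv/= lte_fin uv -EFinB => -[].
  by apply/eqP; rewrite subr_eq0 gt_eqF.
exists x; first by rewrite in_itv in xuv.
have Fr : F y @[y --> x^'+] --> F x.
  apply: fine_cvg; rewrite probK; last exact: measurable_le_set.
  exact: (@cdf_right_continuous _ _ _ P' Zm x).
have Fl : cvg (F y @[y --> x^'-]).
  apply: nondecreasing_at_left_is_cvgr.
    near=> y => s t _ _; exact: prob_le_nondecreasing.
  near=> y; exists 1 => _ [s _ <-]; apply: prob_le1; exact: measurable_le_set.
(* The left limit exists by monotonicity and the right one is F x; as x is not a jump, they
   coincide. *)
have Fc : {for x, continuous F}.
  apply/left_right_continuousP; split => //.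
  have -> : F x = lim (F y @[y --> x^'-]).
    rewrite -(cvg_lim _ Fr)//; apply/esym/eqP; apply: contrapT => /negP ne.
    by apply: nD; split => //; apply/cvg_ex; exists (F x).
  exact: Fl.
have -> : (fun y => P' [set w | Z w <= y]) = EFin \o F.
  by apply/funext => y; rewrite /= probK//; exact: measurable_le_set.
by apply: cvg_EFin; [near=> y|exact: Fc].
Unshelve. all: by end_near. Qed.

(** A continuity point inserted between u and v trades the continuity condition for a gap. In this
    form, which [sandwich_cvg_in_distribution] shows to be sufficient as well, levels can be
    transformed without tracking continuity points. *)
Lemma cvg_in_distribution_sandwich (Y : R -> T -> R) (Z : T' -> R) (u v e : R) :
  cvg_in_distribution P P' Y Z -> u < v -> 0 < e ->
  \forall t \near +oo,
    prob P [set w | Y t w <= u] <= prob P' [set w | Z w <= v] + e /\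
    prob P' [set w | Z w <= u] <= prob P [set w | Y t w <= v] + e.
Proof.
move=> [mY mZ cv] uv e0.
have [x /andP[ux xv] cx] := cdf_continuity_dense mZ uv.
have L : prob P [set w | Y t w <= x] @[t --> +oo] --> prob P' [set w | Z w <= x].
  by apply: fine_cvg; rewrite probK; [exact: cv|exact: measurable_le_set].
near=> t.
have : `|prob P' [set w | Z w <= x] - prob P [set w | Y t w <= x]| < e.
  by near: t; exact: cvgr_dist_lt L _ e0.
rewrite ltr_norml => /andP[l1 l2].
have p1 : prob P [set w | Y t w <= u] <= prob P [set w | Y t w <= x].
  apply: prob_le; [exact: measurable_le_set|exact: measurable_le_set|].
  by move=> w /= /le_trans; apply; exact: ltW.
have p2 : prob P [set w | Y t w <= x] <= prob P [set w | Y t w <= v].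
  apply: prob_le; [exact: measurable_le_set|exact: measurable_le_set|].
  by move=> w /= /le_trans; apply; exact: ltW.
have p3 := prob_le_nondecreasing mZ (ltW ux).
have p4 := prob_le_nondecreasing mZ (ltW xv).
by split; lra.
Unshelve. all: by end_near. Qed.

(** At a continuity point x the gaps from x - dl / 2 to x and from x to x + dl / 2 change the limit
    law by less than e / 2, and the sandwich costs another e / 2. *)
Lemma sandwich_cvg_in_distribution (Y : R -> T -> R) (Z : T' -> R) :
  (forall t, measurable_fun [set: T] (Y t)) -> measurable_fun [set: T'] Z ->
  (forall u v e : R, u < v -> 0 < e -> \forall t \near +oo,
    prob P [set w | Y t w <= u] <= prob P' [set w | Z w <= v] + e /\
    prob P' [set w | Z w <= u] <= prob P [set w | Y t w <= v] + e) ->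
  cvg_in_distribution P P' Y Z.
Proof.
move=> mY mZ sw; split => // x cx.
have mZx y := measurable_le_set y mZ.
have Fc : prob P' [set w | Z w <= y] @[y --> x] --> prob P' [set w | Z w <= x].
  by apply: fine_cvg; rewrite probK.
suff L : prob P [set w | Y t w <= x] @[t --> +oo] --> prob P' [set w | Z w <= x].
  rewrite -probK//.
  have -> : (fun t => P [set w | Y t w <= x]) =
      EFin \o (fun t => prob P [set w | Y t w <= x]).
    by apply/funext => t; rewrite /= probK//; exact: measurable_le_set.
  by apply: cvg_EFin; [near=> t|exact: L].
apply/cvgrPdist_le => e e0; have e20 : 0 < e / 2 by rewrite divr_gt0.
have /nbhs_ballP[dl /= dl0 close] : \forall y \near x,
    `|prob P' [set w | Z w <= x] - prob P' [set w | Z w <= y]| < e / 2.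
  exact: cvgr_dist_lt Fc _ e20.
have dl20 : 0 < dl / 2 by rewrite divr_gt0.
have c1 : `|prob P' [set w | Z w <= x] - prob P' [set w | Z w <= x + dl / 2]| < e / 2.
  apply: (close (x + dl / 2)).
  by rewrite /ball/= opprD addNKr normrN gtr0_norm//; lra.
have c2 : `|prob P' [set w | Z w <= x] - prob P' [set w | Z w <= x - dl / 2]| < e / 2.
  apply: (close (x - dl / 2)).
  by rewrite /ball/= opprB addrC subrK gtr0_norm//; lra.
have s1 := sw x (x + dl / 2) (e / 2); have s2 := sw (x - dl / 2) x (e / 2).
have x1 : x < x + dl / 2 by lra.
have x2 : x - dl / 2 < x by lra.
near=> t.
have [u1 _] : prob P [set w | Y t w <= x] <= prob P' [set w | Z w <= x + dl / 2] + e / 2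
  /\ prob P' [set w | Z w <= x] <= prob P [set w | Y t w <= x + dl / 2] + e / 2.
  by near: t; exact: s1.
have [_ u2] : prob P [set w | Y t w <= x - dl / 2] <= prob P' [set w | Z w <= x] + e / 2
  /\ prob P' [set w | Z w <= x - dl / 2] <= prob P [set w | Y t w <= x] + e / 2.
  by near: t; exact: s2.
move: c1 c2; rewrite ler_norml !ltr_norml => /andP[? ?] /andP[? ?].
by apply/andP; split; lra.
Unshelve. all: by end_near. Qed.

End convergence_of_cdf.

Lemma prob_leU d (T : measurableType d) (R : realType) (P : probability T R)
    (A B C : set T) : measurable A -> measurable B -> measurable C ->
  (forall w, A w -> B w \/ C w) -> prob P A <= prob P B + prob P C.
Proof.
move=> mA mB mC ABC; apply: le_trans (probU P mB mC).
by apply: prob_le => //; exact: measurableU.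
Qed.

(** The gap between y and y' absorbs a small relative change of c, in either direction. *)
Lemma slack (R : realType) (c y y' : R) : 0 < c -> 0 < y -> y < y' ->
  exists eta : R, [/\ 0 < eta, eta < c, c * y < (c - eta) * y' &
                      (c + eta) * y < c * y'].
Proof.
move=> c0 y0 yy'; have y'0 : 0 < y' by lra.
(* Chosen so that e y' is half the gap; with eta = c e, both strict inequalities then pass through c
   (y + y') / 2. *)
pose e := (y' - y) / (2 * y').
have e0 : 0 < e by rewrite divr_gt0 ?mulr_gt0//; lra.
have ey : e * y' = (y' - y) / 2 by rewrite /e; field; rewrite gt_eqF.
have e1 : e < 1 by nra.
have ce0 : 0 < c * e by exact: mulr_gt0.
have h1 : 0 < c * (y' - y) by rewrite mulr_gt0// subr_gt0.
have h2 : c * e * y' = c * ((y' - y) / 2) by rewrite -mulrA ey.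
have h3 : c * e * y < c * e * y' by rewrite ltr_pM2l.
by exists (c * e); split; [exact: mulr_gt0|rewrite gtr_pMr|lra|lra].
Qed.

(** * Slutsky's theorem for products and quotients with a square root *)

Section slutsky.
Context d d' (T : measurableType d) (T' : measurableType d') (R : realType).
Variables (P : probability T R) (P' : probability T' R).

Variables (U V : R -> T -> R) (Lambda : T' -> R) (c : R).
Hypothesis c_gt0 : 0 < c.
Hypothesis U_cvg : cvg_in_distribution P P' U Lambda.
Hypothesis Lambda_gt0 : P' [set w | 0 < Lambda w] = 1%E.

Let mU (t : R) : measurable_fun [set: T] (U t). Proof. by have [] := U_cvg. Qed.
Let mL : measurable_fun [set: T'] Lambda. Proof. by have [] := U_cvg. Qed.
Let mUle (t y : R) : measurable [set w | U t w <= y].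
Proof. exact: measurable_le_set. Qed.
Let mLle (y : R) : measurable [set w | Lambda w <= y].
Proof. exact: measurable_le_set. Qed.

Let Lambda_le0 : prob P' [set w | Lambda w <= 0] = 0.
Proof.
have -> : [set w | Lambda w <= 0] = ~` [set w | 0 < Lambda w].
  apply/seteqP; split=> w /=.
    by move=> ?; apply/negP; rewrite -leNgt.
  by move=> h; case: (leP (Lambda w) 0) => // /h.
have m1 : measurable [set w | 0 < Lambda w].
  have := measurableC (mLle 0); congr measurable.
  apply/seteqP; split=> w /=; rewrite ltNge; first by move/negP.
  by move=> ?; apply/negP.
by rewrite probC// /prob Lambda_gt0 subrr.
Qed.

Let Lm : {RV P' >-> R} :=
  HB.pack Lambda (isMeasurableFun.Build _ _ _ _ Lambda mL).

(** The distribution function of Lambda is right-continuous and vanishes at 0, hence is small at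
    some v > 0; halving v leaves the gap that the sandwich needs. *)
Lemma normalized_away_from0 (e : R) : 0 < e -> exists2 dl : R, 0 < dl &
  \forall t \near +oo, prob P [set w | U t w <= dl] <= e.
Proof.
move=> e0; have e20 : 0 < e / 2 by rewrite divr_gt0.
have Fr : prob P' [set w | Lambda w <= y] @[y --> (0 : R)^'+] --> (0 : R).
  rewrite -[X in _ --> X]Lambda_le0.
  apply: fine_cvg; rewrite probK//.
  exact: (@cdf_right_continuous _ _ _ P' Lm 0).
have [v [v0 hv]] : exists v, 0 < v /\ prob P' [set w | Lambda w <= v] < e / 2.
  near (0 : R)^'+ => v; exists v; split; first by near: v; exact: nbhs_right_gt.
  by near: v; exact: (cvgr_lt _ Fr).
exists (v / 2); first by rewrite divr_gt0.
have vv : v / 2 < v by lra.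
near=> t.
have [s _] : prob P [set w | U t w <= v / 2] <= prob P' [set w | Lambda w <= v] + e / 2
    /\ prob P' [set w | Lambda w <= v / 2] <= prob P [set w | U t w <= v] + e / 2.
  by near: t; exact: cvg_in_distribution_sandwich.
by lra.
Unshelve. all: by end_near. Qed.

Lemma normalized_bounded (e : R) : 0 < e -> exists2 M : R, 0 < M &
  \forall t \near +oo, 1 - prob P [set w | U t w <= M] <= e.
Proof.
move=> e0; have e20 : 0 < e / 2 by rewrite divr_gt0.
have Fr : prob P' [set w | Lambda w <= y] @[y --> +oo] --> (1 : R).
  by apply: fine_cvg; exact: (@cvg_cdfy1 _ _ _ P' Lm).
have [v [v0 hv]] : exists v, 0 < v /\ 1 - e / 2 < prob P' [set w | Lambda w <= v].
  near (pinfty_nbhs R) => v; exists v; split; first by near: v; exact: nbhs_pinfty_gt.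
  by near: v; apply: cvgr_gt Fr _ _; lra.
exists (v + 1); first by lra.
have vv : v < v + 1 by lra.
near=> t.
have [_ s] : prob P [set w | U t w <= v] <= prob P' [set w | Lambda w <= v + 1] + e / 2
    /\ prob P' [set w | Lambda w <= v] <= prob P [set w | U t w <= v + 1] + e / 2.
  by near: t; exact: cvg_in_distribution_sandwich.
by lra.
Unshelve. all: by end_near. Qed.

Hypothesis mV : forall t, measurable_fun [set: T] (V t).
Hypothesis V_cvg : forall eta e : R, 0 < eta -> 0 < e ->
  \forall t \near +oo, prob P [set w | eta <= `|V t w - c|] <= e.

Let mdev (t eta : R) : measurable [set w | eta <= `|V t w - c|].
Proof.
apply: measurable_ge; apply: measurableT_comp => //.
exact: measurable_funB.
Qed.

Let V_near (t eta : R) (w : T) : ~ (eta <= `|V t w - c|) -> c - eta < V t w < c + eta.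
Proof.
move=> /negP; rewrite -ltNge ltr_norml => /andP[h1 h2].
by apply/andP; split; lra.
Qed.

(** Outside |V - c| >= eta, Y <= y forces U <= (y1 / (c - eta))^2, and U <= (y' / (c + eta))^2
    forces Y <= y'. By [slack] these levels leave a gap to (y' / c)^2 and (y1 / c)^2, where the
    sandwich of U and Lambda applies. *)
Lemma slutsky_sqrt_mul (Y : R -> T -> R) :
  (forall t, measurable_fun [set: T] (Y t)) ->
  (\forall t \near +oo, forall w, Y t w = Num.sqrt (U t w) * V t w) ->
  cvg_in_distribution P P' Y (fun w => c * Num.sqrt (Lambda w)).
Proof.
move=> mY YE; have c0 := c_gt0.
have mZ : measurable_fun [set: T'] (fun w => c * Num.sqrt (Lambda w)).
  apply: measurable_funM => //; apply: measurableT_comp => //.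
  exact: measurable_sqrtr.
apply: sandwich_cvg_in_distribution => // y y' e yy' e0.
have e20 : 0 < e / 2 by rewrite divr_gt0.
(* Below 0 the limit has no mass, and Y is nonnegative as soon as V > c / 2. *)
have [y0|y0] := ltP y 0.
  near=> t; split.
    apply: (@le_trans _ _ e); last by rewrite ler_wpDl// prob_ge0.
    apply: (@le_trans _ _ (prob P [set w | c / 2 <= `|V t w - c|])).
      apply: prob_le => //; first exact: measurable_le_set.
      move=> w /=; rewrite (near YE t)// => Yy.
      apply: contrapT => /V_near/andP[v1 _].
      have : 0 <= Num.sqrt (U t w) * V t w.
        by apply: mulr_ge0; [exact: sqrtr_ge0|lra].
      by lra.
    by near: t; apply: V_cvg => //; lra.
  rewrite (_ : [set w | _] = set0).
    by rewrite {1}/prob measure0/= addr_ge0 ?prob_ge0 ?(ltW e0).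
  apply/seteqP; split=> // w /=.
  have : 0 <= c * Num.sqrt (Lambda w) by apply: mulr_ge0; rewrite ?sqrtr_ge0 ?(ltW c_gt0).
  by lra.
(* As y may be 0 and [slack] needs a positive lower level, y is first raised to y1. *)
have [y1 [y10 y1y' yy1]] : exists y1 : R, [/\ 0 < y1, y1 < y' & y < y1].
  by exists ((y + y') / 2); split; lra.
have y'0 : 0 < y' by lra.
have [eta [eta0 etac s1 s2]] := slack c_gt0 y10 y1y'.
have ce0 : 0 < c - eta by lra.
have ce0' : 0 < c + eta by lra.
have lt1 : (y1 / (c - eta)) ^+ 2 < (y' / c) ^+ 2.
  rewrite ltr_sqr ?nnegrE ?divr_ge0 ?(ltW y10) ?(ltW y'0) ?(ltW ce0) ?(ltW c_gt0)//.
  by rewrite ltr_pdivrMr// mulrAC ltr_pdivlMr// mulrC [y' * _]mulrC.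
have lt2 : (y1 / c) ^+ 2 < (y' / (c + eta)) ^+ 2.
  rewrite ltr_sqr ?nnegrE ?divr_ge0 ?(ltW y10) ?(ltW y'0) ?(ltW ce0') ?(ltW c_gt0)//.
  by rewrite ltr_pdivrMr// mulrAC ltr_pdivlMr// mulrC [y' * _]mulrC.
near=> t.
have dv : prob P [set w | eta <= `|V t w - c|] <= e / 2.
  by near: t; exact: V_cvg.
have [sw1 _] : prob P [set w | U t w <= (y1 / (c - eta)) ^+ 2] <=
      prob P' [set w | Lambda w <= (y' / c) ^+ 2] + e / 2 /\
    prob P' [set w | Lambda w <= (y1 / (c - eta)) ^+ 2] <=
      prob P [set w | U t w <= (y' / c) ^+ 2] + e / 2.
  by near: t; exact: cvg_in_distribution_sandwich.
have [_ sw2] : prob P [set w | U t w <= (y1 / c) ^+ 2] <=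
      prob P' [set w | Lambda w <= (y' / (c + eta)) ^+ 2] + e / 2 /\
    prob P' [set w | Lambda w <= (y1 / c) ^+ 2] <=
      prob P [set w | U t w <= (y' / (c + eta)) ^+ 2] + e / 2.
  by near: t; exact: cvg_in_distribution_sandwich.
have YEt w : Y t w = Num.sqrt (U t w) * V t w by move: w; near: t.
have sqrt_le (x z : R) : 0 <= z -> x <= z ^+ 2 -> Num.sqrt x <= z.
  by move=> z0 xz; rewrite (le_trans (ler_wsqrtr xz))// sqrtr_sqr ger0_norm.
have le_sqrt (x z : R) : 0 <= z -> Num.sqrt x <= z -> x <= z ^+ 2.
  move=> z0 xz; have [x0|x0] := leP x 0.
    by rewrite (le_trans x0)// sqr_ge0.
  by rewrite -(sqr_sqrtr (ltW x0)) ler_sqr ?nnegrE ?sqrtr_ge0.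
split.
- have q1 : prob P [set w | Y t w <= y] <=
      prob P [set w | eta <= `|V t w - c|] +
      prob P [set w | U t w <= (y1 / (c - eta)) ^+ 2].
    apply: prob_leU => //; first exact: measurable_le_set.
    move=> w /=; rewrite YEt => Yy.
    have [?|/V_near/andP[v1 _]] := pselect (eta <= `|V t w - c|); first by left.
    right; apply: le_sqrt; first by rewrite divr_ge0 ?ltW.
    rewrite ler_pdivlMr//; have := sqrtr_ge0 (U t w); nra.
  have q2 : prob P' [set w | Lambda w <= (y' / c) ^+ 2] <=
      prob P' [set w | c * Num.sqrt (Lambda w) <= y'].
    apply: prob_le => //; first exact: measurable_le_set.
    move=> w /= /sqrt_le; rewrite divr_ge0 ?(ltW y'0) ?(ltW c_gt0)// => /(_ isT).
    by rewrite ler_pdivlMr// mulrC.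
  by lra.
- have q1 : prob P' [set w | c * Num.sqrt (Lambda w) <= y] <=
      prob P' [set w | Lambda w <= (y1 / c) ^+ 2].
    apply: prob_le => //; first exact: measurable_le_set.
    move=> w /= Zy; apply: le_sqrt; first by rewrite divr_ge0 ?ltW.
    by rewrite ler_pdivlMr// mulrC; lra.
  have q2 : prob P [set w | U t w <= (y' / (c + eta)) ^+ 2] <=
      prob P [set w | eta <= `|V t w - c|] + prob P [set w | Y t w <= y'].
    apply: prob_leU => //; first exact: measurable_le_set.
    move=> w /= /sqrt_le; rewrite divr_ge0 ?(ltW y'0) ?(ltW ce0')// => /(_ isT).
    rewrite ler_pdivlMr// YEt => Uy.
    have [?|/V_near/andP[_ v1]] := pselect (eta <= `|V t w - c|); first by left.
    right; have := sqrtr_ge0 (U t w); nra.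
  by lra.
Unshelve. all: by end_near. Qed.

(** Division reverses the order, so the sandwich is applied to complements. Where U <= 0, the
    convention 0^-1 = 0 makes the quotient 0 instead of large; such points are charged to the event
    U <= dl, and on the side of the limit to the null event Lambda <= 0. *)
Lemma slutsky_sqrt_div (Y : R -> T -> R) :
  (forall t, measurable_fun [set: T] (Y t)) ->
  (\forall t \near +oo, forall w, Y t w = V t w / Num.sqrt (U t w)) ->
  cvg_in_distribution P P' Y (fun w => c * (1 / Num.sqrt (Lambda w))).
Proof.
move=> mY YE; have c0 := c_gt0.
have mZ : measurable_fun [set: T'] (fun w => c * (1 / Num.sqrt (Lambda w))).
  apply: measurable_funM => //; apply: measurable_funM => //.
  apply: (measurableT_comp (@measurable_invr R)).
  by apply: (measurableT_comp (@measurable_sqrtr R)).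
apply: sandwich_cvg_in_distribution => // y y' e yy' e0.
have e20 : 0 < e / 2 by rewrite divr_gt0.
(* Error budget: e / 4 for V far from c, e / 4 for U near 0, and e / 2 for the sandwich. *)
have e40 : 0 < e / 4 by rewrite divr_gt0.
have mYle t x : measurable [set w | Y t w <= x] by exact: measurable_le_set.
have mZle x : measurable [set w | c * (1 / Num.sqrt (Lambda w)) <= x].
  exact: measurable_le_set.
have Z_le0 x : x <= 0 -> prob P' [set w | c * (1 / Num.sqrt (Lambda w)) <= x] <= 0.
  move=> x0; rewrite -Lambda_le0; apply: prob_le => //.
  move=> w /= Zx; rewrite leNgt; apply/negP => L0.
  have : 0 < c * (1 / Num.sqrt (Lambda w)) by rewrite mulr_gt0// divr_gt0// sqrtr_gt0.
  by lra.
(* The case split is on y': if y' > 0 a positive y1 fits between y and y' whatever the sign of y,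
   and otherwise y < 0 makes both probabilities at level y negligible. *)
have [y'0|y'0] := leP y' 0.
  near=> t; split.
    apply: (@le_trans _ _ e); last by rewrite ler_wpDl// prob_ge0.
    apply: (@le_trans _ _ (prob P [set w | c / 2 <= `|V t w - c|])).
      apply: prob_le => // w /=; rewrite (near YE t)// => Yy.
      apply: contrapT => /V_near/andP[v1 _].
      have : 0 <= V t w / Num.sqrt (U t w).
        by rewrite divr_ge0 ?sqrtr_ge0//; lra.
      by lra.
    by near: t; apply: V_cvg => //; lra.
  rewrite (le_trans (Z_le0 _ _)) ?addr_ge0 ?prob_ge0 ?(ltW e0)//; lra.
have [y1 [y10 y1y' yy1]] : exists y1 : R, [/\ 0 < y1, y1 < y' & y < y1].
  by have [y0|y0] := leP y 0; [exists (y' / 2)|exists ((y + y') / 2)]; split; lra.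
have [eta [eta0 etac s1 s2]] := slack c_gt0 y10 y1y'.
have ce0 : 0 < c - eta by lra.
have ce0' : 0 < c + eta by lra.
have lt1 : (c / y') ^+ 2 < ((c - eta) / y1) ^+ 2.
  rewrite ltr_sqr ?nnegrE ?divr_ge0 ?(ltW y10) ?(ltW y'0) ?(ltW ce0) ?(ltW c_gt0)//.
  by rewrite ltr_pdivrMr// mulrAC ltr_pdivlMr.
have lt2 : ((c + eta) / y') ^+ 2 < (c / y1) ^+ 2.
  rewrite ltr_sqr ?nnegrE ?divr_ge0 ?(ltW y10) ?(ltW y'0) ?(ltW ce0') ?(ltW c_gt0)//.
  by rewrite ltr_pdivrMr// mulrAC ltr_pdivlMr.
have [dl dl0 Udl] := normalized_away_from0 e40.
near=> t.
have dv : prob P [set w | eta <= `|V t w - c|] <= e / 4.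
  by near: t; exact: V_cvg.
have U0 : prob P [set w | U t w <= dl] <= e / 4 by near: t.
have [_ sw1] : prob P [set w | U t w <= (c / y') ^+ 2] <=
      prob P' [set w | Lambda w <= ((c - eta) / y1) ^+ 2] + e / 2 /\
    prob P' [set w | Lambda w <= (c / y') ^+ 2] <=
      prob P [set w | U t w <= ((c - eta) / y1) ^+ 2] + e / 2.
  by near: t; exact: cvg_in_distribution_sandwich.
have [sw2 _] : prob P [set w | U t w <= ((c + eta) / y') ^+ 2] <=
      prob P' [set w | Lambda w <= (c / y1) ^+ 2] + e / 2 /\
    prob P' [set w | Lambda w <= ((c + eta) / y') ^+ 2] <=
      prob P [set w | U t w <= (c / y1) ^+ 2] + e / 2.
  by near: t; exact: cvg_in_distribution_sandwich.
have YEt w : Y t w = V t w / Num.sqrt (U t w) by move: w; near: t.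
have gt_sqrt (x z : R) : 0 <= z -> z < Num.sqrt x -> ~ x <= z ^+ 2.
  move=> z0 zx xz; have := le_lt_trans (ler_wsqrtr xz).
  by rewrite sqrtr_sqr ger0_norm// => /(_ _ zx); rewrite ltxx.
have sqrt_gt (x z : R) : 0 <= z -> ~ x <= z ^+ 2 -> z < Num.sqrt x.
  move=> z0 /negP; rewrite -ltNge => xz.
  have x0 : 0 < x by rewrite (le_lt_trans _ xz)// sqr_ge0.
  by rewrite -(@ltr_sqr _ z) ?nnegrE ?sqrtr_ge0// sqr_sqrtr// ltW.
split.
- have q1 : prob P [set w | Y t w <= y] <=
      prob P ([set w | eta <= `|V t w - c|] `|` [set w | U t w <= dl]) +
      prob P (~` [set w | U t w <= ((c - eta) / y1) ^+ 2]).
    apply: prob_leU => //; [exact: measurableU|exact: measurableC|].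
    move=> w /=; rewrite YEt => Yy.
    have [?|/V_near/andP[v1 _]] := pselect (eta <= `|V t w - c|); first by left; left.
    have [?|/negP] := pselect (U t w <= dl); first by left; right.
    rewrite -ltNge => Udw; right; apply: gt_sqrt; first by rewrite divr_ge0 ?ltW.
    have sU : 0 < Num.sqrt (U t w) by rewrite sqrtr_gt0; lra.
    rewrite ltr_pdivrMr// mulrC; move: Yy; rewrite ler_pdivrMr// => Yy.
    nra.
  have q2 : prob P' (~` [set w | Lambda w <= (c / y') ^+ 2]) <=
      prob P' [set w | c * (1 / Num.sqrt (Lambda w)) <= y'].
    apply: prob_le => //; first exact: measurableC.
    move=> w /= /sqrt_gt; rewrite divr_ge0 ?(ltW y'0) ?(ltW c_gt0)// => /(_ isT) h.
    have sL : 0 < Num.sqrt (Lambda w) by rewrite (lt_trans _ h)// divr_gt0.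
    rewrite mulrA mulr1 ler_pdivrMr//; move: h; rewrite ltr_pdivrMr//; lra.
  have q3 := probU P (mdev t eta) (mUle t dl).
  by move: q1 q2; rewrite !probC//; lra.
- have q1 : prob P' [set w | c * (1 / Num.sqrt (Lambda w)) <= y] <=
      prob P' [set w | Lambda w <= 0] +
      prob P' (~` [set w | Lambda w <= (c / y1) ^+ 2]).
    apply: prob_leU => //; first exact: measurableC.
    move=> w /=; rewrite mulrA mulr1 => Zy.
    have [?|L0] := leP (Lambda w) 0; first by left.
    right; apply: gt_sqrt; first by rewrite divr_ge0 ?ltW.
    have sL : 0 < Num.sqrt (Lambda w) by rewrite sqrtr_gt0.
    rewrite ltr_pdivrMr// mulrC; move: Zy; rewrite ler_pdivrMr// => Zy.
    nra.
  have q2 : prob P (~` [set w | U t w <= ((c + eta) / y') ^+ 2]) <=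
      prob P [set w | eta <= `|V t w - c|] + prob P [set w | Y t w <= y'].
    apply: prob_leU => //; first exact: measurableC.
    move=> w /= /sqrt_gt; rewrite divr_ge0 ?(ltW y'0) ?(ltW ce0')// => /(_ isT) h.
    have sU : 0 < Num.sqrt (U t w) by rewrite (lt_trans _ h)// divr_gt0.
    have [?|/V_near/andP[_ v1]] := pselect (eta <= `|V t w - c|); first by left.
    right; rewrite YEt ler_pdivrMr//; move: h; rewrite ltr_pdivrMr//; lra.
  by move: q1 q2; rewrite !probC// Lambda_le0; lra.
Unshelve. all: by end_near. Qed.

End slutsky.

(** * The two limit laws *)

Theorem mainTheorem10 (R : realType)
    (d : measure_display) (T : measurableType d) (P : probability T R)
    (d' : measure_display) (T' : measurableType d') (P' : probability T' R)
    (X : {RV P >-> R}) (X_ : nat -> {RV P >-> R})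
    (N : R -> {RV P >-> nat}) (Lambda : {RV P' >-> R})
    (ell : R -> R) (a : R -> R) :
  P [set w | 0 < X w] = 1%E ->
  iid_copies X X_ ->
  counting_process N ->
  process_independent N X_ ->
  pareto_type X 2 ell ->
  mu_ X 2 = +oo%E ->
  D_averages_in_time N Lambda ->
  (forall x : R, 0 < x ->
    lebesgue_measure.-integrable `]0, x] (fun u => (ell u / u)%:E)) ->
  a t @[t --> +oo] --> +oo ->
  t * a t ^- 2 * tilde_ell ell (a t) @[t --> +oo] --> (1 : R) ->
  [/\ slowly_varying (tilde_ell ell),
      cvg_in_distribution P P'
        (fun t w => Num.sqrt (N t w)%:R / a t * CoVar X_ (N t) w)
        (fun w => Num.sqrt 2 / fine (mu_ X 1) * Num.sqrt (Lambda w)) &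
      cvg_in_distribution P P'
        (fun t w => t / a t * (CoVar X_ (N t) w / Num.sqrt (N t w)%:R))
        (fun w => Num.sqrt 2 / fine (mu_ X 1) * (1 / Num.sqrt (Lambda w)))].
Proof.
move=> X_gt0 X_iid _ N_indep X_pareto mu2 [N_cvg Lambda_gt0] ell_int a_pinfty a_norm.
set c := Num.sqrt 2 / fine (mu_ X 1).
have c_gt0 : 0 < c by rewrite divr_gt0 ?sqrtr_gt0//; exact: mu1_gt0 X_pareto mu2.
pose U t w : R := (N t w)%:R / t.
pose V t w : R := Num.sqrt t / a t * CoVar X_ (N t) w.
have mNR t : measurable_fun [set: T] (fun w => (N t w)%:R : R).
  by apply: (measurableT_comp (f := fun n : nat => n%:R : R)).
have mNS t : measurable_fun [set: T] (fun w => Num.sqrt (N t w)%:R : R).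
  exact: (measurableT_comp (@measurable_sqrtr R)).
have mC t := measurable_random_covar X_ N t.
have mV t : measurable_fun [set: T] (V t) by exact: measurable_funM.
have V_cvg (eta e : R) : 0 < eta -> 0 < e ->
    \forall t \near +oo, prob P [set w | eta <= `|V t w - c|] <= e.
  move=> eta0 e0; have e30 : 0 < e / 3 by rewrite divr_gt0.
  (* The window [dl t, M t] for N(t) is fixed before t grows; each end and the deviation inside cost
     e / 3. *)
  have [dl dl0 Udl] := normalized_away_from0 N_cvg Lambda_gt0 e30.
  have [M M0 UM] := normalized_bounded N_cvg e30.
  near=> t.
  have t0 : 0 < t by near: t; exact: nbhs_pinfty_gt.
  have h1 : prob P [set w | U t w <= dl] <= e / 3 by near: t.
  have h2 : 1 - prob P [set w | U t w <= M] <= e / 3 by near: t.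
  have h3 : forall n, dl * t <= n%:R -> n%:R <= M * t ->
      prob P (covar_deviation X_ (Num.sqrt t / a t) c eta n) <= e / 3.
    near: t; exact: (covar_in_probability X_gt0 X_iid X_pareto mu2 ell_int
      a_pinfty a_norm dl0 M0 eta0 e30).
  have := prob_random_deviation N_indep t0 (ltW e30) h3.
  by move: h1 h2; rewrite /U /V; lra.
have sqrtU t w : 0 < t -> Num.sqrt (U t w) = Num.sqrt (N t w)%:R / Num.sqrt t.
  by move=> t0; rewrite /U sqrtrM ?ler0n// sqrtrV// ltW.
split.
- exact: (slowly_varying_tilde_ell X_gt0 X_pareto mu2 ell_int).
- apply: (slutsky_sqrt_mul c_gt0 N_cvg mV V_cvg).
    by move=> t; apply: measurable_funM => //; exact: measurable_funM.
  near=> t => w.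
  have t0 : 0 < t by near: t; exact: nbhs_pinfty_gt.
  have a0 : 0 < a t by near: t; exact: cvgry_gt.
  have s0 : 0 < Num.sqrt t by rewrite sqrtr_gt0.
  by rewrite sqrtU// /V; field; rewrite !gt_eqF.
- apply: (slutsky_sqrt_div c_gt0 N_cvg Lambda_gt0 mV V_cvg).
    move=> t; apply: measurable_funM => //; apply: measurable_funM => //.
    exact: (measurableT_comp (@measurable_invr R)).
  near=> t => w.
  have t0 : 0 < t by near: t; exact: nbhs_pinfty_gt.
  have a0 : 0 < a t by near: t; exact: cvgry_gt.
  have s0 : 0 < Num.sqrt t by rewrite sqrtr_gt0.
  (* One t is written as the square of sqrt t. The inverse of [Num.sqrt (N t w)%:R] stays a single
     factor, so N(t) = 0 needs no separate case. *)
  rewrite sqrtU// /V invf_div -{1}(sqr_sqrtr (ltW t0)) expr2.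
  by rewrite [RHS]mulrACA [in RHS]mulrA; ring.
Unshelve. all: by end_near. Qed.
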